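(* Let $\sigma$ be a function on the Riemannian manifold $(M,g)$, let $\nabla$ be the metric connection with vectorial torsion defined by the vector field $V=-\mathrm{grad}(\sigma)$ (gradient with respect to $g$), and consider the conformally equivalent metric $\tilde g=e^{2\sigma}g$, with Levi-Civita connection $\nabla^{\tilde g}$. Then: (1) Any $\nabla$-geodesic $\gamma(t)$ is, up to a reparametrisation $\tau$, a $\nabla^{\tilde g}$-geodesic (that is, $\gamma^*:=\gamma\circ\tau$ satisfies $\nabla^{\tilde g}_{\dot\gamma^*}\dot\gamma^*=0$), and the function $\tau$ is the unique solution of the differential equation $\ddot\tau+\dot\tau\,\dot\sigma=0$, where one sets $\sigma(t):=(\sigma\circ\gamma\circ\tau)(t)$. (2) If $X$ is a Killing vector field for the metric $\tilde g$, the function $e^{\sigma}g(\dot\gamma,X)$ is a constant of motion for the $\nabla$-geodesic $\gamma(t)$, i.e. it is constant along $\gamma$.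
   Context: For a Riemannian manifold $(M,g)$ with Levi-Civita connection $\nabla^g$ and a vector field $V$ on $M$, the metric connection with vectorial torsion defined by $V$ is $$\nabla_XY=\nabla^g_XY+g(X,Y)V-g(V,Y)X.$$ A $\nabla$-geodesic is a curve $\gamma$ with $\nabla_{\dot\gamma}\dot\gamma=0$, i.e. $\nabla^g_{\dot\gamma}\dot\gamma+g(\dot\gamma,\dot\gamma)V-g(V,\dot\gamma)\dot\gamma=0$. Since $\nabla$ is metric, $\|\dot\gamma\|$ is a constant $E$, and $E>0$ is assumed. A Killing vector field for a metric is one whose local flow consists of isometries of that metric. *)

(* Defs.v *)
From HB Require Import structures.
From mathcomp Require Import all_boot all_order all_algebra.
From mathcomp Require Import all_classical all_reals all_analysis.
From mathcomp Require Import ring.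

Set Implicit Arguments.
Unset Strict Implicit.
Unset Printing Implicit Defensive.

Import Order.TTheory GRing.Theory Num.Theory.
Import numFieldNormedType.Exports.

Local Open Scope classical_set_scope.
Local Open Scope ring_scope.

(* Used only on open subsets [U] of finite-dimensional spaces, where [Ck_on k]
   lies between C^(k-1) and C^k, so that [smooth_on] is C^infinity. *)
Fixpoint Ck_on (R : realType) (V W : normedModType R) (k : nat) (U : set V)
    (f : V -> W) : Prop :=
  match k with
  | 0 => forall x, U x -> {for x, continuous f}
  | k'.+1 => (forall x, U x -> differentiable f x) /\
             (forall v, Ck_on k' U (fun x => 'D_v f x))
  end.

Definition smooth_on (R : realType) (V W : normedModType R) (U : set V)
    (f : V -> W) : Prop :=
  forall k, Ck_on k U f.

(* A smooth manifold of dimension [n] given by a smooth atlas, not necessarily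
   maximal. The chart [c] is the homeomorphism [chart_coord c] from the open set
   [dom c] onto its open image, with inverse [param c]; the values of these
   maps elsewhere are irrelevant. *)
Record manifold (R : realType) (n : nat) := Manifold {
  carrier :> topologicalType;
  carrier_hausdorff : hausdorff_space carrier;
  carrier_second_countable : @second_countable carrier;
  chart : Type;
  dom : chart -> set carrier;
  chart_coord : chart -> carrier -> 'rV[R]_n;
  param : chart -> 'rV[R]_n -> carrier;
  dom_cover : forall p, exists c, dom c p;
  dom_open : forall c, open (dom c);
  img_open : forall c, open (chart_coord c @` dom c);
  chart_coordK : forall c p, dom c p -> param c (chart_coord c p) = p;
  chart_coord_continuous : forall c p, dom c p -> {for p, continuous (chart_coord c)};
  param_continuous : forall c x,
    (chart_coord c @` dom c) x -> {for x, continuous (param c)};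
  transition_smooth : forall c d,
    smooth_on (chart_coord c @` (dom c `&` dom d)) (chart_coord d \o param c)
}.

Arguments chart {R n} m.

Definition img (R : realType) (n : nat) (M : manifold R n) (c : chart M) :
  set 'rV[R]_n := chart_coord c @` dom c.

Definition smooth_fun (R : realType) (n : nat) (M : manifold R n)
    (f : M -> R) : Prop :=
  forall c : chart M, smooth_on (img c) (f \o param c).

Definition smooth_map_on (R : realType) (n : nat) (M : manifold R n)
    (U : set M) (f : M -> M) : Prop :=
  (forall p, U p -> {for p, continuous f}) /\
  (forall c d : chart M,
     smooth_on (chart_coord c @` [set p | [/\ U p, dom c p & dom d (f p)]])
               (chart_coord d \o f \o param c)).

(* Tensor fields are families of component functions, one for each chart, in
   the coordinates of that chart. A tangent vector at [p] has components
   [v : 'rV_n] in the chart [c], and components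
   ['D_v (chart_coord d \o param c) (chart_coord c p)] in the chart [d]. *)
Definition vector_field (R : realType) (n : nat) (M : manifold R n) :=
  chart M -> 'rV[R]_n -> 'rV[R]_n.

Definition is_vector_field (R : realType) (n : nat) (M : manifold R n)
    (X : vector_field M) : Prop :=
  (forall c, smooth_on (img c) (X c)) /\
  (forall c d p, dom c p -> dom d p ->
     X d (chart_coord d p) =
     'D_(X c (chart_coord c p)) (chart_coord d \o param c) (chart_coord c p)).

Definition metric (R : realType) (n : nat) (M : manifold R n) :=
  chart M -> 'rV[R]_n -> 'M[R]_n.

Definition inner (R : realType) (n : nat) (G : 'M[R]_n) (u v : 'rV[R]_n) : R :=
  (u *m G *m v^T) 0 0.

Definition riemannian (R : realType) (n : nat) (M : manifold R n)
    (g : metric M) : Prop :=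
  [/\ (forall c i j, smooth_on (img c) (fun x => g c x i j)),
      (forall c x, img c x -> (g c x)^T = g c x),
      (forall c x v, img c x -> v != 0 -> 0 < inner (g c x) v v) &
      (forall c d p v w, dom c p -> dom d p ->
         inner (g d (chart_coord d p))
           ('D_v (chart_coord d \o param c) (chart_coord c p))
           ('D_w (chart_coord d \o param c) (chart_coord c p)) =
         inner (g c (chart_coord c p)) v w)].

Definition conformal (R : realType) (n : nat) (M : manifold R n)
    (sigma : M -> R) (g : metric M) : metric M :=
  fun c x => expR (2 * sigma (param c x)) *: g c x.

Definition pd (R : realType) (n : nat) (i : 'I_n) (f : 'rV[R]_n -> R)
    (x : 'rV[R]_n) : R :=
  'D_(delta_mx 0 i) f x.

(* The vector dual to the differential of [sigma], see [gradP]. *)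
Definition grad (R : realType) (n : nat) (M : manifold R n) (g : metric M)
    (sigma : M -> R) : vector_field M :=
  fun c x => (\row_i pd i (sigma \o param c) x) *m invmx (g c x).

(* The coefficients of an affine connection: [C c x u v] is the bilinear map
   with nabla_X Y = 'D_X Y + C X Y in the chart [c]. *)
Definition connection (R : realType) (n : nat) (M : manifold R n) :=
  chart M -> 'rV[R]_n -> 'rV[R]_n -> 'rV[R]_n -> 'rV[R]_n.

Definition cov_deriv (R : realType) (n : nat) (M : manifold R n)
    (C : connection M) (X Y : vector_field M) : vector_field M :=
  fun c x => 'D_(X c x) (Y c) x + C c x (X c x) (Y c x).

(* [christoffel g c x i j k] has lower indices [i], [j] and upper index [k]. *)
Definition christoffel (R : realType) (n : nat) (M : manifold R n)
    (g : metric M) (c : chart M) (x : 'rV[R]_n) (i j k : 'I_n) : R :=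
  2^-1 * \sum_l invmx (g c x) k l *
    (pd i (fun y => g c y j l) x + pd j (fun y => g c y i l) x
     - pd l (fun y => g c y i j) x).

(* The unique torsion-free metric connection, see [levi_civitaP]. *)
Definition levi_civita (R : realType) (n : nat) (M : manifold R n)
    (g : metric M) : connection M :=
  fun c x u v => \row_k \sum_i \sum_j christoffel g c x i j k * u 0 i * v 0 j.

Definition vectorial_connection (R : realType) (n : nat) (M : manifold R n)
    (g : metric M) (V : vector_field M) : connection M :=
  fun c x u v => levi_civita g c x u v
    + inner (g c x) u v *: V c x - inner (g c x) (V c x) v *: u.

Definition smooth_curve (R : realType) (n : nat) (M : manifold R n)
    (I : set R) (gamma : R -> M) : Prop :=
  (forall t, I t -> {for t, continuous gamma}) /\
  (forall c : chart M,
     smooth_on [set t | I t /\ dom c (gamma t)] (chart_coord c \o gamma)).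

Definition velocity (R : realType) (n : nat) (M : manifold R n)
    (gamma : R -> M) (c : chart M) (t : R) : 'rV[R]_n :=
  derive1 (chart_coord c \o gamma) t.

(* [Y] lists the components in the chart [c] of a vector field along [gamma]. *)
Definition cov_deriv_along (R : realType) (n : nat) (M : manifold R n)
    (C : connection M) (gamma : R -> M) (c : chart M) (Y : R -> 'rV[R]_n)
    (t : R) : 'rV[R]_n :=
  derive1 Y t + C c (chart_coord c (gamma t)) (velocity gamma c t) (Y t).

Definition geodesic (R : realType) (n : nat) (M : manifold R n)
    (C : connection M) (I : set R) (gamma : R -> M) : Prop :=
  smooth_curve I gamma /\
  (forall c t, I t -> dom c (gamma t) ->
     cov_deriv_along C gamma c (velocity gamma c) t = 0).

Definition speed (R : realType) (n : nat) (M : manifold R n) (g : metric M)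
    (gamma : R -> M) (c : chart M) (t : R) : R :=
  Num.sqrt (inner (g c (chart_coord c (gamma t)))
                  (velocity gamma c t) (velocity gamma c t)).

Definition open_interval (R : realType) (I : set R) : Prop :=
  open I /\ is_interval I.

Definition reparametrisation (R : realType) (J I : set R) (tau : R -> R) :
  Prop :=
  [/\ smooth_on J tau, set_bij J I tau & forall s, J s -> derive1 tau s != 0].

Definition solves_ode (R : realType) (n : nat) (M : manifold R n)
    (sigma : M -> R) (gamma : R -> M) (J : set R) (tau : R -> R) : Prop :=
  forall s, J s ->
    [/\ derivable tau s 1, derivable (derive1 tau) s 1 &
        derive1 (derive1 tau) s
          + derive1 tau s * derive1 (sigma \o gamma \o tau) s = 0].

Definition local_flow (R : realType) (n : nat) (M : manifold R n)
    (X : vector_field M) (eps : R) (U : set M) (Phi : R -> M -> M) : Prop :=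
  [/\ (forall q, U q -> Phi 0 q = q),
      (forall (t : R) (q : M), `|t| < eps -> U q ->
         {for (t, q), continuous (fun z : R * M => Phi z.1 z.2)}),
      (forall c d : chart M, smooth_on
         [set z : R * 'rV[R]_n | [/\ `|z.1| < eps, img c z.2,
            U (param c z.2) & dom d (Phi z.1 (param c z.2))]]
         (fun z => chart_coord d (Phi z.1 (param c z.2)))) &
      (forall (c : chart M) t q, `|t| < eps -> U q -> dom c (Phi t q) ->
         velocity (Phi^~ q) c t = X c (chart_coord c (Phi t q)))].

(* [f] is an isometry from the open set [U] onto its image. *)
Definition isometry_on (R : realType) (n : nat) (M : manifold R n)
    (g : metric M) (U : set M) (f : M -> M) : Prop :=
  [/\ smooth_map_on U f, set_inj U f &
      forall (c d : chart M) p v w, U p -> dom c p -> dom d (f p) ->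
        inner (g d (chart_coord d (f p)))
          ('D_v (chart_coord d \o f \o param c) (chart_coord c p))
          ('D_w (chart_coord d \o f \o param c) (chart_coord c p)) =
        inner (g c (chart_coord c p)) v w].

Definition killing (R : realType) (n : nat) (M : manifold R n)
    (g : metric M) (X : vector_field M) : Prop :=
  is_vector_field X /\
  forall p : M, exists eps U Phi,
    [/\ 0 < eps, open U, U p, local_flow X eps U Phi &
        forall t, `|t| < eps -> isometry_on g U (Phi t)].

Lemma innerE (R : realType) (n : nat) (G : 'M[R]_n) (u v : 'rV[R]_n) :
  inner G u v = \sum_i \sum_j G i j * u 0 i * v 0 j.
Proof.
rewrite /inner mxE exchange_big /=; apply: eq_bigr => j _.
rewrite !mxE mulr_suml; apply: eq_bigr => i _.
by rewrite (mulrC (u 0 i)).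
Qed.

Lemma derive_pd (R : realType) (n : nat) (f : 'rV[R]_n -> R) (x v : 'rV[R]_n) :
  differentiable f x -> 'D_v f x = \sum_i v 0 i * pd i f x.
Proof.
move=> df; rewrite /pd deriveE// {1}(row_sum_delta v) linear_sum.
by apply: eq_bigr => i _; rewrite linearZ deriveE.
Qed.

Lemma riemannian_unit (R : realType) (n : nat) (M : manifold R n)
    (g : metric M) (c : chart M) (x : 'rV[R]_n) :
  riemannian g -> img c x -> g c x \in unitmx.
Proof.
move=> [_ _ pos _] cx; rewrite -row_free_unit -kermx_eq0.
apply/eqP/row_matrixP => i; rewrite row0; apply/eqP/negP => /negP nz.
have := pos c x _ cx nz.
have /sub_kermxP k0 : (row i (kermx (g c x)) <= kermx (g c x))%MS by exact: row_sub.
by rewrite /inner k0 mul0mx mxE ltxx.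
Qed.

Lemma gradP (R : realType) (n : nat) (M : manifold R n) (g : metric M)
    (sigma : M -> R) (c : chart M) (x v : 'rV[R]_n) :
  riemannian g -> smooth_fun sigma -> img c x ->
  inner (g c x) (grad g sigma c x) v = 'D_v (sigma \o param c) x.
Proof.
move=> rg ss cx; rewrite derive_pd; last by have [+ _] := ss c 1%N; apply.
rewrite /inner /grad mulmxKV ?riemannian_unit// mxE; apply: eq_bigr => i _.
by rewrite !mxE mulrC.
Qed.

Lemma inner_inj (R : realType) (n : nat) (M : manifold R n) (g : metric M)
    (c : chart M) (x u v : 'rV[R]_n) :
  riemannian g -> img c x ->
  (forall w, inner (g c x) u w = inner (g c x) v w) -> u = v.
Proof.
move=> [_ _ pos _] cx uv; apply/eqP; rewrite -subr_eq0; apply/negP => /negP nz.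
have := pos c x _ cx nz.
by rewrite {1}/inner !mulmxBl mxE [X in _ + X]mxE -!/(inner _ _ _) uv subrr ltxx.
Qed.

Lemma derive_inner (R : realType) (n : nat) (M : manifold R n) (g : metric M)
    (c : chart M) (x u v w : 'rV[R]_n) :
  riemannian g -> img c x ->
  'D_u (fun y => inner (g c y) v w) x =
  \sum_i \sum_j \sum_k u 0 i * v 0 j * w 0 k * pd i (fun y => g c y j k) x.
Proof.
move=> [sm _ _ _] cx.
have dg i j : differentiable (fun y => g c y i j) x.
  by have [+ _] := sm c i j 1%N; apply.
have -> : (fun y => inner (g c y) v w) =
    \sum_j \sum_k (v 0 j * w 0 k) *: (fun y => g c y j k).
  apply/funext => y; rewrite innerE fct_sumE; apply: eq_bigr => j _.
  rewrite fct_sumE; apply: eq_bigr => k _ /=.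
  by rewrite -mulrA mulrC.
have dv j k : derivable (fun y => g c y j k) x u by exact: diff_derivable.
rewrite derive_sum; last first.
  by move=> j; apply: derivable_sum => k; exact: derivableZ.
rewrite [RHS]exchange_big /=; apply: eq_bigr => j _.
rewrite derive_sum; last by move=> k; exact: derivableZ.
rewrite [RHS]exchange_big /=; apply: eq_bigr => k _.
rewrite deriveZ//= derive_pd// scaler_sumr; apply: eq_bigr => i _.
rewrite -[_ *: _]/(_ * _) !mulrA; congr (_ * _).
by rewrite mulrC mulrA.
Qed.

Lemma koszul (R : realType) (n : nat) (M : manifold R n) (g : metric M)
    (c : chart M) (x u v w : 'rV[R]_n) :
  riemannian g -> img c x ->
  2 * inner (g c x) (levi_civita g c x u v) w =
  'D_u (fun y => inner (g c y) v w) x + 'D_v (fun y => inner (g c y) u w) x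
  - 'D_w (fun y => inner (g c y) u v) x.
Proof.
move=> rg cx; rewrite !derive_inner//.
have [_ gsym _ _] := rg.
have gu := riemannian_unit rg cx.
pose d i j k := pd i (fun y => g c y j k) x.
pose b i j l := d i j l + d j i l - d l i j.
have -> : levi_civita g c x u v =
    2^-1 *: ((\row_l \sum_i \sum_j u 0 i * v 0 j * b i j l) *m invmx (g c x)).
  apply/rowP => k; rewrite !mxE.
  have -> : \sum_i \sum_j christoffel g c x i j k * u 0 i * v 0 j =
      2^-1 * \sum_i \sum_j \sum_l invmx (g c x) l k * (u 0 i * v 0 j * b i j l).
    rewrite mulr_sumr; apply: eq_bigr => i _; rewrite mulr_sumr.
    apply: eq_bigr => j _; rewrite /christoffel -!mulrA; congr (_ * _).
    rewrite mulrA -mulrA mulr_suml; apply: eq_bigr => l _.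
    have -> : invmx (g c x) k l = invmx (g c x) l k.
      by rewrite -[in LHS](gsym c x cx) -trmx_inv mxE.
    by rewrite /b /d; ring.
  congr (_ * _).
  under eq_bigr do rewrite exchange_big /=.
  rewrite exchange_big /=; apply: eq_bigr => l _.
  rewrite mxE mulrC mulr_sumr; apply: eq_bigr => i _.
  by rewrite mulr_sumr.
rewrite /inner -!scalemxAl mxE mulVKf ?pnatr_eq0// mulmxKV// mxE.
transitivity (\sum_i \sum_j \sum_k u 0 i * v 0 j * w 0 k * b i j k).
  under eq_bigr do rewrite !mxE mulr_suml.
  rewrite exchange_big /=; apply: eq_bigr => i _.
  under eq_bigr do rewrite mulr_suml.
  rewrite exchange_big /=; apply: eq_bigr => j _.
  by apply: eq_bigr => k _; rewrite mulrAC.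
have -> : \sum_i \sum_j \sum_k v 0 i * u 0 j * w 0 k * d i j k =
          \sum_i \sum_j \sum_k u 0 i * v 0 j * w 0 k * d j i k.
  rewrite exchange_big /=; apply: eq_bigr => i _; apply: eq_bigr => j _.
  by apply: eq_bigr => k _; rewrite (mulrC (v 0 j)).
have -> : \sum_i \sum_j \sum_k w 0 i * u 0 j * v 0 k * d i j k =
          \sum_i \sum_j \sum_k u 0 i * v 0 j * w 0 k * d k i j.
  rewrite exchange_big /=; apply: eq_bigr => i _.
  rewrite exchange_big /=; apply: eq_bigr => j _; apply: eq_bigr => k _.
  by ring.
rewrite -big_split -sumrB /=; apply: eq_bigr => i _.
rewrite -big_split -sumrB /=; apply: eq_bigr => j _.
rewrite -big_split -sumrB /=; apply: eq_bigr => k _.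
by rewrite -mulrDr -mulrBr.
Qed.

Definition torsion_free (R : realType) (n : nat) (M : manifold R n)
    (C : connection M) : Prop :=
  forall c x u v, img c x -> C c x u v = C c x v u.

Definition metric_connection (R : realType) (n : nat) (M : manifold R n)
    (g : metric M) (C : connection M) : Prop :=
  forall c x u v w, img c x ->
    'D_u (fun y => inner (g c y) v w) x =
    inner (g c x) (C c x u v) w + inner (g c x) v (C c x u w).

Lemma innerC (R : realType) (n : nat) (M : manifold R n) (g : metric M)
    (c : chart M) (x u v : 'rV[R]_n) :
  riemannian g -> img c x -> inner (g c x) u v = inner (g c x) v u.
Proof.
move=> [_ gsym _ _] cx; rewrite /inner -[u *m _ *m _]trmxK mxE !trmx_mul trmxK gsym//.
by rewrite mulmxA.
Qed.

Lemma levi_civitaP (R : realType) (n : nat) (M : manifold R n) (g : metric M)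
    (C : connection M) :
  riemannian g ->
  (torsion_free C /\ metric_connection g C) <->
  (forall c x u v, img c x -> C c x u v = levi_civita g c x u v).
Proof.
move=> rg.
have n2 : (2 : R) != 0 by rewrite pnatr_eq0.
have iC c x u v : img c x -> inner (g c x) u v = inner (g c x) v u by exact: innerC.
have DC c x u v w : img c x ->
    'D_w (fun y => inner (g c y) u v) x = 'D_w (fun y => inner (g c y) v u) x.
  move=> cx; apply: near_eq_derive.
  have : nbhs x (img c) by apply: open_nbhs_nbhs; split=> //; exact: img_open.
  by apply: filterS => y cy; exact: innerC.
split.
  move=> [tf mc] c x u v cx; apply: (inner_inj rg cx) => w.
  apply: (mulfI n2); rewrite koszul// !mc//.
  rewrite (tf c x v u)// (tf c x w u)// (tf c x w v)//.
  rewrite (iC _ _ v)// (iC _ _ u (C c x v w))//.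
  ring.
move=> CE; split=> [c x u v cx|c x u v w cx].
  rewrite !CE//; apply: (inner_inj rg cx) => w; apply: (mulfI n2).
  by rewrite !koszul// (DC c x u v w)//; ring.
rewrite !CE// (iC _ _ v)//; apply: (mulfI n2).
rewrite mulrDr !koszul//.
rewrite (DC _ _ w v u)// (DC _ _ u w v)// (DC _ _ v w u)//; ring.
Qed.

Lemma cov_deriv_vectorial (R : realType) (n : nat) (M : manifold R n)
    (g : metric M) (V X Y : vector_field M) (c : chart M) (x : 'rV[R]_n) :
  cov_deriv (vectorial_connection g V) X Y c x =
  cov_deriv (levi_civita g) X Y c x
  + inner (g c x) (X c x) (Y c x) *: V c x
  - inner (g c x) (V c x) (Y c x) *: X c x.
Proof. by rewrite /cov_deriv /vectorial_connection !addrA. Qed.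

Lemma vectorial_connection_metric (R : realType) (n : nat) (M : manifold R n)
    (g : metric M) (V : vector_field M) :
  riemannian g -> metric_connection g (vectorial_connection g V).
Proof.
move=> rg c x u v w cx.
have [_ mc] : torsion_free (levi_civita g) /\ metric_connection g (levi_civita g).
  by apply/levi_civitaP.
have iC a b : inner (g c x) a b = inner (g c x) b a by exact: innerC.
have innerL a b d k l : inner (g c x) (a + k *: b - l *: d) w =
    inner (g c x) a w + k * inner (g c x) b w - l * inner (g c x) d w.
  by rewrite /inner !mulmxBl !mulmxDl -!scalemxAl !mxE.
have innerR a b d k l : inner (g c x) v (a + k *: b - l *: d) =
    inner (g c x) v a + k * inner (g c x) v b - l * inner (g c x) v d.
  by rewrite 4!(iC v) /inner !mulmxBl !mulmxDl -!scalemxAl !mxE.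
rewrite mc// /vectorial_connection innerL innerR.
by rewrite (iC v (V c x)) (iC v u); ring.
Qed.

(* Main.v *)
(* The Levi-Civita connection of [e^{2 sigma} g] is
   [nabla_X Y + X(sigma) Y], so along the reparametrised curve
   [gamma \o tau] the acceleration for this metric is
   [tau'' + tau' (sigma \o gamma \o tau)'] times the velocity of [gamma] plus
   [tau'^2] times its [nabla]-acceleration: this gives the equation of [tau].
   That equation says that [tau' e^{sigma (gamma tau)}] is constant, so the
   maximal solution is the inverse of a primitive of a multiple of
   [e^{sigma \o gamma}].

   Differentiating the isometries of the flow of [X] at time 0 (the two mixed
   derivatives of the flow coincide) gives the Killing equation
   [X h(v, v) + 2 h(v, D_v X) = 0] for [h = e^{2 sigma} g]. With Koszul's
   formula, [h(gamma', X)' = (sigma \o gamma)' h(gamma', X)], so the derivative of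
   [e^{- sigma} h(gamma', X) = e^sigma g(gamma', X)] vanishes. *)
From HB Require Import structures.
Require Import Defs.
From mathcomp Require Import all_boot all_order all_algebra.
From mathcomp Require Import all_classical all_reals all_analysis.
From mathcomp Require Import ring lra.

Set Implicit Arguments.
Unset Strict Implicit.
Unset Printing Implicit Defensive.

Import Order.TTheory GRing.Theory Num.Theory.
Import numFieldNormedType.Exports.

Local Open Scope classical_set_scope.
Local Open Scope ring_scope.

(** * Calculus of C^k maps *)

(** Differentiability depends only on the germ: the affine approximation of [f] at [x] is also one
    of [h], and [diff_unique] then identifies the differential of [h] with that of [f]. *)
Lemma near_eq_differentiable (R : realType) (V W : normedModType R)
    (f h : V -> W) (x : V) :
  (\near x, f x = h x) -> differentiable f x -> differentiable h x.
Proof.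
move=> fh df.
have fhx : f x = h x by exact: (nbhs_singleton fh).
have fh0 : \forall y \near (0 : V), f (y + x) = h (y + x).
  have : (fun y : V => y + x) @ (0 : V) --> (0 + x).
    by apply: cvgD; [exact: cvg_id|exact: cvg_cst].
  by rewrite add0r => H; exact: (H _ fh).
have key : h \o shift x = cst (h x) + 'd f x +o_ 0 id.
  apply/eqaddoP => e e0.
  have /eqaddoP/(_ _ e0) := diff_locally df.
  apply: filterS2 fh0 => y fhy.
  by rewrite /= !fctE /= fhy fhx.
have hE := diff_unique (diff_continuous df) key.
apply/diff_locallyP; split; rewrite hE //.
exact: diff_continuous.
Qed.

Section Ck.
Variable R : realType.
Implicit Types (V W : normedModType R).

(** [U] only lists the points where the conditions are tested, while derivatives are taken in the
    whole space, so the condition at a single point can be isolated. This lets regularity pass to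
    subsets and be checked chart by chart. *)
Lemma Ck_on_pointwise V W k (U : set V) (f : V -> W) :
  Ck_on k U f <-> forall x, U x -> Ck_on k [set x] f.
Proof.
elim: k f => [|k IH] f /=.
  by split=> [H x Ux _ ->|H x Ux]; [exact: H|exact: (H x Ux x)].
split=> [[df Df] x Ux|H]; first split=> [_ ->|v]; first exact: df.
  by have /IH := Df v; exact.
split=> [x Ux|v]; first by have [h _] := H x Ux; exact: h.
by apply/IH => x Ux; have [_] := H x Ux.
Qed.

Lemma Ck_on_sub V W k (A B : set V) (f : V -> W) :
  A `<=` B -> Ck_on k B f -> Ck_on k A f.
Proof.
by move=> AB /Ck_on_pointwise H; apply/Ck_on_pointwise => x /AB; exact: H.
Qed.

(** Agreement near [x] also holds near every point close to [x], so the directional derivatives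
    agree near [x] and the induction can proceed. *)
Lemma Ck_on_eq V W k (U : set V) (f h : V -> W) :
  (forall x, U x -> \near x, f x = h x) -> Ck_on k U f -> Ck_on k U h.
Proof.
elim: k f h => [|k IH] f h fh /=.
  move=> cf x Ux; have fhx := fh x Ux.
  rewrite /prop_for /continuous_at -(nbhs_singleton fhx).
  exact: cvg_trans (near_eq_cvg fhx) (cf x Ux).
move=> [df Df]; split=> [x Ux|v].
  exact: near_eq_differentiable (fh x Ux) (df x Ux).
apply: IH (Df v) => x Ux.
have := fh x Ux => /near_join; apply: filterS => y; exact: near_eq_derive.
Qed.

Lemma Ck_on_open_eq V W k (U : set V) (f h : V -> W) : open U ->
  (forall x, U x -> f x = h x) -> Ck_on k U f -> Ck_on k U h.
Proof.
move=> oU fh; apply: Ck_on_eq => x Ux.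
have : nbhs x U by exact: open_nbhs_nbhs.
exact: filterS.
Qed.

Lemma Ck_onS V W k (U : set V) (f : V -> W) : Ck_on k.+1 U f -> Ck_on k U f.
Proof.
elim: k f => [|k IH] f; move=> [df Df].
  by move=> x Ux; exact/differentiable_continuous/df.
by split=> // v; exact: IH (Df v).
Qed.

Lemma Ck_on_cst V W k (U : set V) (a : W) : Ck_on k U (fun=> a).
Proof.
elim: k a => [|k IH] a /=; first by move=> x _; exact: cvg_cst.
split=> [x _|v]; first exact: differentiable_cst.
have -> : (fun x : V => 'D_v (fun=> a) x) = fun=> 0.
  by apply/funext => x; exact: derive_cst.
exact: IH.
Qed.

Lemma Ck_onD V W k (U : set V) (f h : V -> W) : open U ->
  Ck_on k U f -> Ck_on k U h -> Ck_on k U (fun x => f x + h x).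
Proof.
move=> oU; elim: k f h => [|k IH] f h.
  by move=> cf ch x Ux; apply: cvgD; [exact: cf|exact: ch].
move=> [df Df] [dh Dh]; split=> [x Ux|v].
  by apply: differentiableD; [exact: df|exact: dh].
apply: Ck_on_open_eq (IH _ _ (Df v) (Dh v)) => // x Ux.
by rewrite -deriveD //; apply: diff_derivable; [exact: df|exact: dh].
Qed.

Lemma Ck_on_sum V W k (U : set V) n (f : 'I_n -> V -> W) : open U ->
  (forall i, Ck_on k U (f i)) -> Ck_on k U (fun x => \sum_i f i x).
Proof.
move=> oU; elim: n f => [|n IH] f H.
  by under eq_fun do rewrite big_ord0; exact: Ck_on_cst.
under eq_fun do rewrite big_ord_recl.
by apply: Ck_onD => //; exact: IH.
Qed.

Lemma Ck_on_linear V W W' k (U : set V) (L : {linear W -> W'}) (f : V -> W) :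
  open U -> continuous L -> Ck_on k U f -> Ck_on k U (fun x => L (f x)).
Proof.
move=> oU cL; elim: k f => [|k IH] f.
  by move=> cf x Ux; apply: continuous_comp; [exact: cf|exact: cL].
move=> [df Df].
have dL y : differentiable L y by exact: linear_differentiable.
split=> [x Ux|v].
  by apply: differentiable_comp => //; exact: df.
apply: Ck_on_open_eq (IH _ (Df v)) => // x Ux.
rewrite !deriveE; [|exact/differentiable_comp/dL/df|exact: df].
by rewrite (diff_comp (df x Ux) (dL _)) /= diff_lin.
Qed.

Section scale.
Variables V W : normedModType R.

(** A named copy of scalar multiplication carries the bilinear structure; the differential of a
    continuous bilinear map is then the source of the product rule. *)
Let scale (a : R) (w : W) := a *: w.

Let scale_is_bilinear :
  bilinear_for
    (GRing.Scale.Law.clone _ _ *:%R _) (GRing.Scale.Law.clone _ _ *:%R _)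
    scale.
Proof.
rewrite /scale; split=> [u'|u] a x y /=; first by rewrite scalerDl scalerA.
by rewrite scalerDr !scalerA mulrC.
Qed.

HB.instance Definition _ :=
  bilinear_isBilinear.Build R R W W _ _ scale scale_is_bilinear.

Let scale_diff (p : R * W) : differentiable (fun q : R * W => scale q.1 q.2) p
  /\ 'd (fun q : R * W => scale q.1 q.2) p =
    (fun q => scale p.1 q.2 + scale q.1 p.2) :> (R * W -> W).
Proof.
have c : continuous (fun q : R * W => scale q.1 q.2) by exact: scale_continuous.
by split; [exact: differentiable_bilin|exact: diff_bilin].
Qed.

Lemma differentiable_scale (a : V -> R) (f : V -> W) x :
  differentiable a x -> differentiable f x ->
  differentiable (fun y => a y *: f y) x.
Proof.
move=> da df.
apply: (@differentiable_comp _ _ _ _ (fun y => (a y, f y))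
  (fun q : R * W => scale q.1 q.2)); first exact: differentiable_pair.
by have [] := scale_diff (a x, f x).
Qed.

Lemma derive_scale (a : V -> R) (f : V -> W) x v :
  differentiable a x -> differentiable f x ->
  'D_v (fun y => a y *: f y) x = 'D_v a x *: f x + a x *: 'D_v f x.
Proof.
move=> da df; rewrite !deriveE //; last exact: differentiable_scale.
have [dS dSE] := scale_diff (a x, f x).
have := @diff_comp _ _ _ _ (fun y => (a y, f y))
  (fun q : R * W => scale q.1 q.2) x (differentiable_pair da df) dS.
rewrite [X in 'd X x](_ : _ = fun y => a y *: f y)// => ->.
by rewrite /= dSE diff_pair //= addrC.
Qed.

(** Each term of the product rule keeps one factor undifferentiated, so the induction also needs [a]
    and [f] themselves at the lower order, which [Ck_onS] supplies. *)
Lemma Ck_on_scale k (U : set V) (a : V -> R) (f : V -> W) : open U ->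
  Ck_on k U a -> Ck_on k U f -> Ck_on k U (fun x => a x *: f x).
Proof.
move=> oU; elim: k a f => [|k IH] a f.
  by move=> ca cf x Ux; apply: cvgZ; [exact: ca|exact: cf].
move=> ha hf; have ha' := Ck_onS ha; have hf' := Ck_onS hf.
move: ha hf => [da Da] [df Df]; split=> [x Ux|v].
  by apply: differentiable_scale; [exact: da|exact: df].
apply: (@Ck_on_open_eq _ _ _ _
  (fun x => 'D_v a x *: f x + a x *: 'D_v f x)) => //.
  by move=> x Ux; rewrite derive_scale //; [exact: da|exact: df].
by apply: Ck_onD => //; [exact: (IH _ _ (Da v) hf')|exact: (IH _ _ ha' (Df v))].
Qed.

End scale.

Lemma Ck_onM V k (U : set V) (a b : V -> R) : open U ->
  Ck_on k U a -> Ck_on k U b -> Ck_on k U (fun x => a x * b x).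
Proof. exact: Ck_on_scale. Qed.

(* The middle space is finite-dimensional, with basis [e] and coordinates [l],
   because [Ck_on] only speaks of directional derivatives in constant
   directions. *)
Lemma Ck_on_comp_basis V W V' n (e : 'I_n -> V) (l : 'I_n -> {linear V -> R})
    k (A : set V') (B : set V) (x : V' -> V) (f : V -> W) :
  (forall i, continuous (l i)) -> (forall v, v = \sum_i l i v *: e i) ->
  open A -> open B -> (forall y, A y -> B (x y)) ->
  Ck_on k A x -> Ck_on k B f -> Ck_on k A (f \o x).
Proof.
move=> cl lE oA oB AB; elim: k f => [|k IH] f.
  move=> cx cf y Ay.
  by apply: continuous_comp; [exact: cx|exact/cf/AB].
move=> hx; have hx' := Ck_onS hx; move: hx => [dx Dx] [df Df].
split=> [y Ay|v].
  by apply: differentiable_comp; [exact: dx|exact/df/AB].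
apply: (@Ck_on_open_eq _ _ _ _
  (fun y => \sum_i l i ('D_v x y) *: 'D_(e i) f (x y))) => //.
  move=> y Ay; have dfy := df _ (AB _ Ay); have dxy := dx _ Ay.
  rewrite (@deriveE _ _ _ (f \o x)); last exact: differentiable_comp.
  rewrite (diff_comp dxy dfy) /= -(deriveE _ dxy) {2}(lE ('D_v x y)) linear_sum.
  by apply: eq_bigr => i _; rewrite linearZ (deriveE _ dfy).
apply: Ck_on_sum => // i; apply: Ck_on_scale => //.
  exact: (Ck_on_linear oA (cl i) (Dx v)).
exact: (IH _ hx' (Df _)).
Qed.

Lemma Ck_on_comp_real V W k (A : set V) (B : set R) (x : V -> R) (f : R -> W) :
  open A -> open B -> (forall y, A y -> B (x y)) ->
  Ck_on k A x -> Ck_on k B f -> Ck_on k A (f \o x).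
Proof.
apply: (@Ck_on_comp_basis R W V 1 (fun=> 1) (fun=> idfun)) => [_|v].
  by move=> y; exact: cvg_id.
by rewrite big_ord1 /= [_ *: _]mulr1.
Qed.

Lemma continuous_coord n i : continuous (fun v : 'rV[R]_n => v 0 i).
Proof. by move=> v; exact/differentiable_continuous/differentiable_coord. Qed.

Section coord.
Variable n : nat.
Variable i : 'I_n.
(** Coordinates are given a name so that a linear structure can be attached to them. *)
Definition coord_fun (v : 'rV[R]_n) : R := v 0 i.
Lemma coord_fun_linear : linear coord_fun.
Proof. by move=> a u v; rewrite /coord_fun !mxE. Qed.
HB.instance Definition _ := GRing.isLinear.Build _ _ _ _ _ coord_fun_linear.
End coord.

Lemma Ck_on_coord V k (U : set V) n (x : V -> 'rV[R]_n) i : open U ->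
  Ck_on k U x -> Ck_on k U (fun y => x y 0 i).
Proof.
move=> oU; apply: (@Ck_on_linear _ _ _ k U (@coord_fun n i)) => //.
exact: continuous_coord.
Qed.

Lemma Ck_on_comp V W k n (A : set V) (B : set 'rV[R]_n) (x : V -> 'rV[R]_n)
    (f : 'rV[R]_n -> W) :
  open A -> open B -> (forall y, A y -> B (x y)) ->
  Ck_on k A x -> Ck_on k B f -> Ck_on k A (f \o x).
Proof.
apply: (@Ck_on_comp_basis _ W V n (fun i => delta_mx 0 i) (@coord_fun n)) => [i|v].
  exact: continuous_coord.
by rewrite {1}(row_sum_delta v).
Qed.

Lemma smooth_differentiable V W (U : set V) (f : V -> W) x :
  smooth_on U f -> U x -> differentiable f x.
Proof. by move=> sf Ux; have [h _] := sf 1%N; exact: h. Qed.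

Lemma smooth_derive V W (U : set V) (f : V -> W) v :
  smooth_on U f -> smooth_on U (fun x => 'D_v f x).
Proof. by move=> sf k; have [_ h] := sf k.+1; exact: h. Qed.

Lemma smooth_expR : smooth_on setT (@expR R).
Proof.
move=> k; elim: k => [|k IH] /=; first by move=> x _; exact: continuous_expR.
split=> [x _|v]; first exact/derivable1_diffP/derivable_expR.
have -> : (fun x : R => 'D_v (@expR R) x) = fun x => v *: expR x.
  apply/funext => x; rewrite deriveE; last exact/derivable1_diffP/derivable_expR.
  rewrite diff1E; last exact/derivable1_diffP/derivable_expR.
  by rewrite derive1E derive_val.
apply: (@Ck_on_linear _ _ _ k setT ( *:%R v)) IH; first exact: openT.
exact: scaler_continuous.
Qed.

End Ck.

(** * Symmetry of second derivatives *)

Lemma MVT_derivable (R : realType) (f : R -> R) (a b : R) : a < b ->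
  (forall t, a <= t <= b -> derivable f t 1) ->
  exists2 c, a <= c <= b & f b - f a = 'D_1 f c * (b - a).
Proof.
move=> ab df.
have [t||c] := @MVT _ f (fun t => 'D_1 f t) a b ab.
- by rewrite in_itv /= => /andP[? ?]; apply/derivableP/df; rewrite !ltW.
- by apply: derivable_within_continuous => t; rewrite in_itv /=; exact: df.
- by rewrite in_itv /= => /andP[? ?] E; exists c => //; rewrite !ltW.
Qed.

Section mixed_derivatives.
Variables (R : realType) (V : normedModType R).

Lemma is_derive_line (W : normedModType R) (f : V -> W) (x v : V) (s : R) :
  differentiable f (s *: v + x) ->
  is_derive s 1 (fun r => f (r *: v + x)) ('D_v f (s *: v + x)).
Proof.
move=> df.
have E : (fun h : R => h^-1 *: (f ((h *: (1 : R) + s) *: v + x) - f (s *: v + x))) =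
         (fun h : R => h^-1 *: (f (h *: v + (s *: v + x)) - f (s *: v + x))).
  by apply/funext => h; rewrite [h *: 1]mulr1 scalerDl addrA.
split; last by rewrite /derive E.
by rewrite /derivable E; exact: diff_derivable.
Qed.

(** The second difference of [f] over the rectangle with sides [h *: u] and [h *: v] is symmetric in
    the two sides, whereas the mixed derivative it produces depends on their order. Comparing both
    orders gives the symmetry of second derivatives. *)
Lemma rectangle_MVT (U : set V) (f : V -> R) (x u v : V) (h : R) : 0 < h ->
  Ck_on 2 U f ->
  (forall s r, 0 <= s <= h -> 0 <= r <= h -> U (s *: u + (r *: v + x))) ->
  exists s r, [/\ 0 <= s <= h, 0 <= r <= h &
    f (h *: u + (h *: v + x)) - f (h *: u + x) - (f (h *: v + x) - f x) =
    'D_v (fun y => 'D_u f y) (s *: u + (r *: v + x)) * h ^+ 2].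
Proof.
move=> h0 [df Df] hU.
have [dDu _] := Df u.
have h00 : 0 <= (0 : R) <= h by rewrite lexx ltW.
have hh : 0 <= h <= h by rewrite lexx ltW.
have U1 s : 0 <= s <= h -> U (s *: u + x).
  by move=> sh; have := hU s 0 sh h00; rewrite scale0r add0r.
(* The mean value theorem is used first in the direction [u], for the increment of [f] across the
   side [h *: v], then in the direction [v], for ['D_u f]. *)
pose p s := f (s *: u + (h *: v + x)) - f (s *: u + x).
have dp s : 0 <= s <= h ->
    is_derive s 1 p ('D_u f (s *: u + (h *: v + x)) - 'D_u f (s *: u + x)).
  by move=> sh; apply: is_deriveB; apply: is_derive_line; apply: df;
    [exact: hU|exact: U1].
have [s sh ps] : exists2 s, 0 <= s <= h & p h - p 0 = 'D_1 p s * (h - 0).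
  by apply: MVT_derivable => // s sh; have [] := dp s sh.
have [_ Dps] := dp s sh.
pose q r := 'D_u f (r *: v + (s *: u + x)).
have dq r : 0 <= r <= h ->
    is_derive r 1 q ('D_v (fun y => 'D_u f y) (r *: v + (s *: u + x))).
  by move=> rh; apply: is_derive_line; apply: dDu; rewrite addrCA; exact: hU.
have [r rh qr] : exists2 r, 0 <= r <= h & q h - q 0 = 'D_1 q r * (h - 0).
  by apply: MVT_derivable => // r rh; have [] := dq r rh.
have [_ Dqr] := dq r rh.
exists s, r; split; [exact: sh|exact: rh|].
move: ps; rewrite /p scale0r !add0r => ->; rewrite Dps.
move: qr; rewrite /q scale0r !add0r (addrCA (h *: v)) => ->; rewrite Dqr.
by rewrite (addrCA (r *: v)) subr0 -mulrA.
Qed.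

(** Every small rectangle at the corner [x] contains a point for [A] and a point for [B] with equal
    values; as the rectangles shrink, continuity carries the equality to [x]. *)
Lemma eq_of_small_rectangles (U : set V) (A B : V -> R) (x u v : V) :
  nbhs x U -> {for x, continuous A} -> {for x, continuous B} ->
  (forall h, 0 < h ->
    (forall s r, 0 <= s <= h -> 0 <= r <= h -> U (s *: u + (r *: v + x))) ->
    exists s r s' r', [/\ 0 <= s <= h /\ 0 <= r <= h,
      0 <= s' <= h /\ 0 <= r' <= h &
      A (s *: u + (r *: v + x)) = B (s' *: u + (r' *: v + x))]) ->
  A x = B x.
Proof.
move=> NU cA cB AB.
apply/eqP; rewrite -subr_eq0 -normr_le0; apply/ler_addgt0Pr => e e0.
rewrite add0r.
have e2 : 0 < e / 2 by rewrite divr_gt0.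
have NA : \forall z \near x, `|A x - A z| < e / 2.
  by move/cvgrPdist_lt : cA; apply.
have NB : \forall z \near x, `|B x - B z| < e / 2.
  by move/cvgrPdist_lt : cB; apply.
have [d d0 hd] := (nbhs_ballP _ _).1 (filterI NU (filterI NA NB)).
rewrite /= in d0.
(* The side [h] is chosen so that [h * K] is half the radius [d], which keeps the rectangle inside
   the ball; the summand 1 makes [K] positive even when [u] and [v] vanish. *)
pose K := `|u| + `|v| + 1.
have K0 : 0 < K by rewrite ltr_wpDl.
pose h := d / 2 / K.
have h0 : 0 < h by rewrite !divr_gt0.
have hB s r : 0 <= s <= h -> 0 <= r <= h -> ball x d (s *: u + (r *: v + x)).
  move=> /andP[s0 sh] /andP[r0 rh].
  rewrite -ball_normE /= addrA opprD addrCA subrr addr0 normrN.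
  apply: (le_lt_trans (ler_normD _ _)); rewrite !normrZ !ger0_norm //.
  apply: (@le_lt_trans _ _ (h * (`|u| + `|v|))).
    by rewrite mulrDr lerD // ler_wpM2r.
  apply: (@lt_trans _ _ (h * K)); first by rewrite ltr_pM2l // ltrDl.
  by rewrite /h divfK ?gt_eqF // ltr_pdivrMr // ltr_pMr // ltr1n.
have [s [r [s' [r' [[sh rh] [sh' rh'] E]]]]] :=
  AB h h0 (fun s r sh rh => (hd _ (hB s r sh rh)).1).
have [_ [/= HA _]] := hd _ (hB s r sh rh).
have [_ [_ /= HB]] := hd _ (hB s' r' sh' rh').
rewrite E in HA.
rewrite (splitr e) -(subrKA (B (s' *: u + (r' *: v + x)))).
apply: (le_trans (ler_normD _ _)); rewrite lerD //; first exact: ltW.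
by rewrite distrC ltW.
Qed.

Lemma derive_swap_real (U : set V) (f : V -> R) (x u v : V) : open U -> U x ->
  Ck_on 3 U f -> 'D_u (fun y => 'D_v f y) x = 'D_v (fun y => 'D_u f y) x.
Proof.
move=> oU Ux hf; have hf2 := Ck_onS hf.
have cD a b : {for x, continuous (fun z => 'D_a (fun y => 'D_b f y) z)}.
  have [_ /(_ b) [_ /(_ a) h]] := hf.
  by apply/differentiable_continuous; have [d _] := h; exact: d.
apply: (@eq_of_small_rectangles U (fun z => 'D_u (fun y => 'D_v f y) z)
  (fun z => 'D_v (fun y => 'D_u f y) z) x v u
  (open_nbhs_nbhs (conj oU Ux)) (cD u v) (cD v u)) => h h0 hU.
have [s [r [sh rh E1]]] := rectangle_MVT h0 hf2 hU.
have hU' s' r' : 0 <= s' <= h -> 0 <= r' <= h ->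
    U (s' *: u + (r' *: v + x)).
  by move=> ? ?; rewrite addrCA; exact: hU.
have [s' [r' [sh' rh' E2]]] := rectangle_MVT h0 hf2 hU'.
exists s, r, r', s'; split; [by split|by split|].
(* Multiplied by [h ^+ 2], both mixed derivatives become the same second difference, with its terms
   grouped in two ways. *)
apply: (@mulIf _ (h ^+ 2)); first by rewrite expf_neq0 // gt_eqF.
apply: (etrans (esym E1)); rewrite (addrCA (r' *: v)); apply: (etrans _ E2).
rewrite (addrCA (h *: u)).
by rewrite !opprB addrACA [RHS]addrACA; congr (_ + _); rewrite addrC.
Qed.

Lemma derive_coord n (f : V -> 'rV[R]_n) (x v : V) i : differentiable f x ->
  ('D_v f x) 0 i = 'D_v (fun y => f y 0 i) x.
Proof. by move=> df; rewrite derive_mx ?mxE //; exact: diff_derivable. Qed.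

Lemma derive_swap n (U : set V) (f : V -> 'rV[R]_n) (x u v : V) :
  open U -> U x -> smooth_on U f ->
  'D_u (fun y => 'D_v f y) x = 'D_v (fun y => 'D_u f y) x.
Proof.
move=> oU Ux sf; apply/rowP => i.
have NU : nbhs x U by exact: open_nbhs_nbhs.
have D2 a b : ('D_a (fun y => 'D_b f y) x) 0 i =
    'D_a (fun y => 'D_b (fun z => f z 0 i) y) x.
  rewrite derive_coord; last exact: smooth_differentiable (smooth_derive _ sf) Ux.
  apply: near_eq_derive; apply: filterS NU => y Uy.
  by apply: derive_coord; exact: smooth_differentiable Uy.
apply: (etrans (D2 u v)); apply: (etrans _ (esym (D2 v u))).
exact: (derive_swap_real _ _ oU Ux (Ck_on_coord i oU (sf 3%N))).
Qed.

End mixed_derivatives.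

(** * The conformal metric *)

Lemma innerZ (R : realType) n (a : R) (G : 'M[R]_n) u v :
  inner (a *: G) u v = a * inner G u v.
Proof. by rewrite /inner -scalemxAr -scalemxAl mxE. Qed.

Lemma innerZl (R : realType) n (G : 'M[R]_n) (a : R) u v :
  inner G (a *: u) v = a * inner G u v.
Proof. by rewrite /inner -!scalemxAl mxE. Qed.

Lemma innerDl (R : realType) n (G : 'M[R]_n) u v w :
  inner G (u + v) w = inner G u w + inner G v w.
Proof. by rewrite /inner !mulmxDl mxE. Qed.

Lemma innerNl (R : realType) n (G : 'M[R]_n) u v :
  inner G (- u) v = - inner G u v.
Proof. by rewrite -scaleN1r innerZl mulN1r. Qed.

Section product_rule.
Variables (R : realType) (V : normedModType R) (n : nat).

Lemma differentiable_inner (G : V -> 'M[R]_n) (a b : V -> 'rV[R]_n) x :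
  (forall i j, differentiable (fun y => G y i j) x) ->
  differentiable a x -> differentiable b x ->
  differentiable (fun y => inner (G y) (a y) (b y)) x.
Proof.
move=> dG da db.
have -> : (fun y => inner (G y) (a y) (b y)) =
    \sum_i \sum_j (fun y => G y i j * a y 0 i * b y 0 j).
  apply/funext => y; rewrite innerE fct_sumE; apply: eq_bigr => i _.
  by rewrite fct_sumE.
apply: differentiable_sum => i; apply: differentiable_sum => j.
apply: (@differentiableM _ _ (fun y => G y i j * a y 0 i) (fun y => b y 0 j)).
  apply: (@differentiableM _ _ (fun y => G y i j) (fun y => a y 0 i)) => //.
  exact: (@differentiable_comp _ _ _ _ a (fun v => v 0 i) _ da
    (differentiable_coord _ _ _)).
exact: (@differentiable_comp _ _ _ _ b (fun v => v 0 j) _ db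
  (differentiable_coord _ _ _)).
Qed.

Lemma derive_inner_fun (G : V -> 'M[R]_n) (a b : V -> 'rV[R]_n) x u :
  (forall i j, differentiable (fun y => G y i j) x) ->
  differentiable a x -> differentiable b x ->
  'D_u (fun y => inner (G y) (a y) (b y)) x =
  'D_u (fun y => inner (G y) (a x) (b x)) x +
  inner (G x) ('D_u a x) (b x) + inner (G x) (a x) ('D_u b x).
Proof.
move=> dG da db.
have dc (f : V -> 'rV[R]_n) i : differentiable f x ->
    is_derive x u (fun y => f y 0 i) (('D_u f x) 0 i).
  move=> df; rewrite derive_coord //; apply/derivableP/diff_derivable.
  exact: (@differentiable_comp _ _ _ _ f (fun v => v 0 i) _ df
    (differentiable_coord _ _ _)).
(* The expansion in components is needed twice: for [a] and [b], and for the constant maps [a x] and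
   [b x], where only the derivative of [G] survives. *)
have H (f h : V -> 'rV[R]_n) : differentiable f x -> differentiable h x ->
    'D_u (fun y => inner (G y) (f y) (h y)) x =
    \sum_i \sum_j ('D_u (fun y => G y i j) x * f x 0 i * h x 0 j +
      G x i j * ('D_u f x) 0 i * h x 0 j + G x i j * f x 0 i * ('D_u h x) 0 j).
  move=> df dh.
  have -> : (fun y => inner (G y) (f y) (h y)) =
      \sum_i \sum_j (fun y => G y i j * f y 0 i * h y 0 j).
    apply/funext => y; rewrite innerE fct_sumE; apply: eq_bigr => i _.
    by rewrite fct_sumE.
  have D i j : is_derive x u (fun y => G y i j * f y 0 i * h y 0 j)
      ('D_u (fun y => G y i j) x * f x 0 i * h x 0 j +
      G x i j * ('D_u f x) 0 i * h x 0 j + G x i j * f x 0 i * ('D_u h x) 0 j).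
    have DG : is_derive x u (fun y => G y i j) ('D_u (fun y => G y i j) x).
      exact/derivableP/diff_derivable.
    have := is_deriveM (is_deriveM DG (dc f i df)) (dc h j dh).
    move/is_derive_eq; apply; rewrite /= !fctE /GRing.scale /=; ring.
  have [_ ->] : is_derive x u (\sum_i \sum_j (fun y => G y i j * f y 0 i * h y 0 j)) 
     (\sum_i \sum_j ('D_u (fun y => G y i j) x * f x 0 i * h x 0 j +
      G x i j * ('D_u f x) 0 i * h x 0 j + G x i j * f x 0 i * ('D_u h x) 0 j)).
    by apply: is_derive_sum => i; apply: is_derive_sum.
  by [].
rewrite H // (H (fun=> a x) (fun=> b x)) ?derive_cst; [|exact: differentiable_cst..].
rewrite !innerE -!big_split /=; apply: eq_bigr => i _.
rewrite -!big_split /=; apply: eq_bigr => j _.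
by rewrite !mxE; ring.
Qed.

End product_rule.

Lemma derive_comp (R : realType) (U V W : normedModType R) (x : U -> V)
    (f : V -> W) (t v : U) :
  differentiable x t -> differentiable f (x t) ->
  'D_v (f \o x) t = 'D_('D_v x t) f (x t).
Proof.
move=> dx df; rewrite !deriveE //; last exact: differentiable_comp.
by rewrite diff_comp.
Qed.

Section conformal_metric.
Variables (R : realType) (n : nat) (M : manifold R n).

Lemma img_param (c : chart M) x : img c x ->
  dom c (param c x) /\ chart_coord c (param c x) = x.
Proof. by move=> [p cp <-]; rewrite chart_coordK. Qed.

Lemma img_coord (c : chart M) p : dom c p -> img c (chart_coord c p).
Proof. by move=> cp; exists p. Qed.

Lemma nbhs_img (c : chart M) x : img c x -> nbhs x (img c).
Proof. by move=> cx; apply: open_nbhs_nbhs; split=> //; exact: img_open. Qed.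

Lemma nbhs_dom (c : chart M) p : dom c p -> nbhs p (dom c).
Proof. by move=> cp; apply: open_nbhs_nbhs; split=> //; exact: dom_open. Qed.

Lemma smooth_fun_differentiable (f : M -> R) (c : chart M) x :
  smooth_fun f -> img c x -> differentiable (f \o param c) x.
Proof. by move=> sf; exact: smooth_differentiable. Qed.

Lemma metric_differentiable (g : metric M) (c : chart M) x i j :
  riemannian g -> img c x -> differentiable (fun y => g c y i j) x.
Proof. by move=> [sg _ _ _]; exact: smooth_differentiable. Qed.

Lemma conformal_riemannian (sigma : M -> R) (g : metric M) :
  riemannian g -> smooth_fun sigma -> riemannian (conformal sigma g).
Proof.
move=> [sg symg posg trg] ss; split.
- move=> c i j k.
  apply: (@Ck_on_open_eq _ _ _ _ _
    (fun x => expR (2 * sigma (param c x)) * g c x i j)); first exact: img_open.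
    by move=> x _; rewrite /conformal mxE.
  apply: Ck_onM; [exact: img_open| |exact: sg].
  apply: (@Ck_on_comp_real _ _ _ _ _ setT (fun x => 2 * sigma (param c x))
    (@expR R)); [exact: img_open|exact: openT|by []| |exact: smooth_expR].
  by apply: Ck_onM; [exact: img_open|exact: Ck_on_cst|exact: ss].
- by move=> c x cx; rewrite /conformal linearZ /= symg.
- by move=> c x v cx v0; rewrite innerZ mulr_gt0 ?expR_gt0 // posg.
- by move=> c d p v w cp dp; rewrite !innerZ !chart_coordK // trg.
Qed.

Lemma derive_conformal_inner (sigma : M -> R) (g : metric M) (c : chart M) x
    (u v w : 'rV[R]_n) :
  riemannian g -> smooth_fun sigma -> img c x ->
  'D_u (fun y => inner (conformal sigma g c y) v w) x =
  expR (2 * sigma (param c x)) *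
    (2 * 'D_u (sigma \o param c) x * inner (g c x) v w +
     'D_u (fun y => inner (g c y) v w) x).
Proof.
move=> rg ss cx; have ds := smooth_fun_differentiable ss cx.
have dg : differentiable (fun y => inner (g c y) v w) x.
  apply: differentiable_inner => *; try exact: differentiable_cst.
  exact: metric_differentiable.
have -> : (fun y => inner (conformal sigma g c y) v w) =
    (expR \o (2 *: (sigma \o param c))) * (fun y => inner (g c y) v w).
  by apply/funext => y; rewrite innerZ.
have ds2 : differentiable (2 *: (sigma \o param c)) x by exact: differentiableZ.
have de y : differentiable (@expR R) y by exact/derivable1_diffP/derivable_expR.
have DE : 'D_u (expR \o (2 *: (sigma \o param c))) x =
    expR (2 * sigma (param c x)) * (2 * 'D_u (sigma \o param c) x).
  rewrite (@derive_comp _ _ _ _ (2 *: (sigma \o param c))) //.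
  rewrite deriveZ; last exact: diff_derivable.
  rewrite deriveE // diff1E // derive1E derive_val /= mulrC.
  by [].
rewrite deriveM; [|exact/diff_derivable/differentiable_comp|exact: diff_derivable].
rewrite DE /GRing.scale /= /GRing.scale /= !fctE /GRing.scale /=; ring.
Qed.

(** Koszul's formula for both metrics, tested against [w], leaves [u(sigma) g(v,w) + v(sigma) g(u,w)
    - w(sigma) g(u,v)] as the difference. The last two terms are the torsion terms for the field
    [- grad sigma]; the first is the extra multiple of [v]. *)
Lemma levi_civita_conformal (sigma : M -> R) (g : metric M) (c : chart M) x
    (u v : 'rV[R]_n) :
  riemannian g -> smooth_fun sigma -> img c x ->
  levi_civita (conformal sigma g) c x u v =
  vectorial_connection g (fun c x => - grad g sigma c x) c x u v +
    'D_u (sigma \o param c) x *: v.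
Proof.
move=> rg ss cx; apply: (inner_inj rg cx) => w.
have n2 : (2 : R) != 0 by rewrite pnatr_eq0.
have e0 : expR (2 * sigma (param c x)) != 0 by rewrite gt_eqF // expR_gt0.
have K := koszul u v w (conformal_riemannian rg ss) cx.
rewrite !derive_conformal_inner // innerZ in K.
apply: (mulfI n2); apply: (mulfI e0).
rewrite mulrCA K !innerDl !innerNl !innerZl !innerNl !gradP //.
have := koszul u v w rg cx.
move: (inner (g c x) (levi_civita g c x u v) w) => L HL.
rewrite -!mulrDr -mulrBr; congr (_ * _).
rewrite !mulrDr HL; ring.
Qed.

End conformal_metric.

(** * The Killing equation *)

Section partial_derivatives.
Variables (R : realType) (V W : normedModType R).

Lemma derive_pair_snd (f : R * V -> W) (s : R) (x v : V) :
  'D_v (fun y => f (s, y)) x = 'D_((0 : R), v) f (s, x).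
Proof.
rewrite /derive; set d := (fun _ : R => _); set d' := (fun _ : R => _).
suff -> : d = d' by []; apply/funext => h; rewrite /d /d' /=.
by congr (_ *: (f _ - _)); congr pair; rewrite /= scaler0 add0r.
Qed.

Lemma derive_pair_fst (f : R * V -> W) (s : R) (x : V) :
  derive1 (fun r => f (r, x)) s = 'D_((1 : R), (0 : V)) f (s, x).
Proof.
rewrite /derive1 /derive; set d := (fun _ : R => _); set d' := (fun _ : R => _).
suff -> : d = d' by []; apply/funext => h; rewrite /d /d' /=.
congr (_ *: (f _ - _)); congr pair; rewrite /= ?scaler0 ?add0r //.
by rewrite [_ *: _]mulr1.
Qed.

End partial_derivatives.

Section killing.
Variables (R : realType) (n : nat) (M : manifold R n).

(** This is the domain on which the flow is smooth in coordinates. Its openness, which rests on the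
    joint continuity of the flow, is what permits exchanging the time and space derivatives. *)
Lemma flow_chart_open (X : vector_field M) eps U Phi (c d : chart M) :
  open U -> local_flow X eps U Phi ->
  open [set z : R * 'rV[R]_n | [/\ `|z.1| < eps, img c z.2,
            U (param c z.2) & dom d (Phi z.1 (param c z.2))]].
Proof.
move=> oU [_ cPhi _ _]; rewrite openE => z /= [z1 cz Uz dz].
have Nimg : \forall w \near z, img c w.2.
  by apply: (cvg_snd (F := nbhs z.1) (G := nbhs z.2)); exact: nbhs_img.
have cparam : (fun w : R * 'rV[R]_n => param c w.2) @ z --> param c z.2.
  apply: (@continuous_comp _ _ _ snd (param c)); first exact: cvg_snd.
  exact: param_continuous.
have NU : \forall w \near z, U (param c w.2).
  by apply: (cparam U); exact: open_nbhs_nbhs.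
have Neps : \forall w \near z, `|w.1| < eps.
  have cn : (fun w : R * 'rV[R]_n => `|w.1|) @ z --> `|z.1|.
    by apply: cvg_norm; exact: cvg_fst.
  by apply: (cn [set y | y < eps]); apply: open_nbhs_nbhs; split=> //;
    exact: open_lt.
have cflow : (fun w : R * 'rV[R]_n => Phi w.1 (param c w.2)) @ z -->
    Phi z.1 (param c z.2).
  apply: (@continuous2_cvg _ _ _ _ _ _ fst (fun w => param c w.2) Phi).
  - exact: (cPhi _ _ z1 Uz).
  - exact: cvg_fst.
  - exact: cparam.
have Nd : \forall w \near z, dom d (Phi w.1 (param c w.2)).
  by apply: (cflow (dom d)); exact: nbhs_dom.
by near=> w; split; near: w.
Unshelve. all: by end_near. Qed.

Lemma killing_equation (h : metric M) (X : vector_field M) (c : chart M) x v :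
  riemannian h -> killing h X -> img c x ->
  'D_(X c x) (fun y => inner (h c y) v v) x +
  2 * inner (h c x) v ('D_v (X c) x) = 0.
Proof.
move=> rh [[sX _] flowX] cx.
have [cp cpx] := img_param cx.
have [eps [U [Phi [eps0 oU Up FX isoX]]]] := flowX (param c x).
have [Phi0 _ sPhi dPhi] := FX.
pose S := [set z : R * 'rV[R]_n | [/\ `|z.1| < eps, img c z.2,
            U (param c z.2) & dom c (Phi z.1 (param c z.2))]].
have oS : open S by exact: flow_chart_open FX.
pose phi (z : R * 'rV[R]_n) := chart_coord c (Phi z.1 (param c z.2)).
have sphi : smooth_on S phi by exact: sPhi.
have S0 y : img c y -> U (param c y) -> S (0, y).
  move=> cy Uy; split => //=; first by rewrite normr0.
  by rewrite Phi0 //; have [] := img_param cy.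
have S0x : S (0, x) by exact: S0.
have cparam : param c @ x --> param c x by exact: param_continuous.
have NU : \forall y \near x, img c y /\ U (param c y).
  apply: filterI; first exact: nbhs_img.
  by apply: (cparam U); exact: open_nbhs_nbhs.
(* This identity and the next hold at time 0 only, but for all [y] near [x], so both can still be
   differentiated in the space direction [v]. *)
have phi0 : \forall y \near x, phi (0, y) = y.
  by apply: filterS NU => y [cy Uy]; rewrite /phi /= Phi0 // (img_param cy).2.
have phiX : \forall y \near x, 'D_((1 : R), (0 : 'rV[R]_n)) phi (0, y) = X c y.
  apply: filterS NU => y [cy Uy]; have [cq cqy] := img_param cy.
  rewrite -derive_pair_fst.
  have := dPhi c 0 (param c y); rewrite normr0 Phi0 // cqy => <- //.
(* [w s] is the image of [v] under the differential of the time-[s] flow map at [x]. *)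
pose w s := 'D_((0 : R), v) phi (s, x).
have dpair : differentiable (fun s : R => (s, x)) 0.
  by apply: differentiable_pair; [exact: ex_diff|exact: differentiable_cst].
have S_near : \forall s \near (0 : R), S (s, x).
  have cs : (fun s : R => (s, x)) @ (0 : R) --> ((0 : R), x).
    exact: differentiable_continuous dpair.
  by apply: (cs S); exact: open_nbhs_nbhs.
have iso : \forall s \near (0 : R),
    inner (h c (phi (s, x))) (w s) (w s) = inner (h c x) v v.
  apply: filterS S_near => s [/= s_eps _ _ ds].
  have [_ _ /(_ c c _ v v Up cp ds)] := isoX s s_eps.
  by rewrite cpx /w -derive_pair_snd.
have dfst (W : normedModType R) (f : R * 'rV[R]_n -> W) :
    differentiable f (0, x) -> differentiable (fun s => f (s, x)) 0.
  exact: (@differentiable_comp _ _ _ _ (fun s : R => (s, x)) f).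
have dphi : differentiable phi (0, x) by exact: smooth_differentiable S0x.
have dw : differentiable ('D_((0 : R), v) phi) (0, x).
  exact: smooth_differentiable (smooth_derive _ sphi) S0x.
have dphis : differentiable (fun s : R => phi (s, x)) 0.
  exact: (dfst _ _ dphi).
have dws : differentiable w 0 by exact: (dfst _ _ dw).
have phix : phi (0, x) = x by exact: nbhs_singleton phi0.
have w0 : w 0 = v.
  rewrite /w -derive_pair_snd -[RHS](derive_id x v).
  exact: near_eq_derive.
have Dphi : 'D_1 (fun s : R => phi (s, x)) 0 = X c x.
  rewrite -derive1E derive_pair_fst; exact: nbhs_singleton phiX.
(* The time derivative of the differential of the flow is the space derivative of its velocity, by
   symmetry of the mixed derivatives. *)
have Dw : 'D_1 w 0 = 'D_v (X c) x.
  rewrite -derive1E; apply: (etrans (derive_pair_fst ('D_((0 : R), v) phi) 0 x)).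
  apply: (etrans (derive_swap _ _ oS S0x sphi)).
  rewrite -derive_pair_snd; exact: near_eq_derive.
have dh i j : differentiable (fun y => h c y i j) (phi (0, x)).
  by rewrite phix; exact: metric_differentiable.
have dhs i j : differentiable (fun s : R => h c (phi (s, x)) i j) 0.
  exact: (@differentiable_comp _ _ _ _ (fun s : R => phi (s, x))
    (fun y => h c y i j)).
(* The isometry property makes this function of time constant near 0; its derivative, expanded by
   the product rule, is the left-hand side of the Killing equation. *)
have D0 : 'D_1 (fun s : R => inner (h c (phi (s, x))) (w s) (w s)) 0 = 0.
  by rewrite (near_eq_derive _ iso) derive_cst.
have Dw2 := @derive_inner_fun R R n (fun s => h c (phi (s, x))) w w 0 1 dhs dws dws.
move: (etrans (esym Dw2) D0); rewrite Dw w0.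
have -> : 'D_1 (fun s : R => inner (h c (phi (s, x))) v v) 0 =
    'D_(X c x) (fun y => inner (h c y) v v) x.
  transitivity ('D_('D_1 (fun s : R => phi (s, x)) 0)
    (fun y => inner (h c y) v v) (phi (0, x))); last by rewrite Dphi phix.
  apply: (@derive_comp _ _ _ _ (fun s : R => phi (s, x))
    (fun y => inner (h c y) v v) 0 1 dphis).
  by apply: differentiable_inner dh _ _; exact: differentiable_cst.
by rewrite phix (innerC _ v rh cx) => <-; ring.
Qed.

End killing.

(** * Curves and reparametrisations *)

Lemma derive_eq0_constant (R : realType) (I : set R) (f : R -> R) (a b : R) :
  is_interval I -> (forall t, I t -> is_derive t 1 f 0) -> I a -> I b ->
  f a = f b.
Proof.
move=> iI df.
wlog ab : a b / a <= b => [H|] Ia Ib.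
  by have /orP[ab|ba] := le_total a b; [exact: H|apply/esym; exact: H].
move: ab; rewrite le_eqVlt => /orP[/eqP -> //|ab].
have Iab t : a <= t <= b -> I t by exact: iI.
have [t /Iab It|c /Iab Ic] := @MVT_derivable _ f a b ab.
  by have [] := df t It.
have [_ ->] := df c Ic; rewrite mul0r => /eqP; rewrite subr_eq0 => /eqP.
by [].
Qed.

Lemma nbhs_preimage (T T' : topologicalType) (f : T -> T') (x : T)
    (A : set T') :
  {for x, continuous f} -> open A -> A (f x) -> \forall y \near x, A (f y).
Proof. by move=> cf oA Afx; apply: (cf A); exact: open_nbhs_nbhs. Qed.

Lemma derivable_comp_real (R : realType) (V : normedModType R) (f : R -> V)
    (tau : R -> R) s :
  derivable tau s 1 -> derivable f (tau s) 1 ->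
  is_derive s 1 (f \o tau) (derive1 tau s *: derive1 f (tau s)).
Proof.
move=> /derivable1_diffP dt /derivable1_diffP df; split.
  by apply/derivable1_diffP; exact: differentiable_comp.
rewrite (derive_comp (1 : R) dt df) (deriveE _ df) diff1E // -derive1E.
by [].
Qed.

Section curves.
Variables (R : realType) (n : nat) (M : manifold R n).

Section smooth_curve.
Variables (I : set R) (gamma : R -> M).
Hypotheses (oI : open I) (sgamma : smooth_curve I gamma).

Lemma curve_chart_open (c : chart M) : open [set t | I t /\ dom c (gamma t)].
Proof.
rewrite openE => t [It ct]; apply: filterI; first exact: open_nbhs_nbhs.
have [cg _] := sgamma.
exact: (nbhs_preimage (cg t It) (dom_open c) ct).
Qed.

Lemma curve_differentiable (c : chart M) t : I t -> dom c (gamma t) ->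
  differentiable (chart_coord c \o gamma) t.
Proof.
have [_ /(_ c) sc] := sgamma.
by move=> It ct; exact: (smooth_differentiable sc (conj It ct)).
Qed.

Lemma velocityE c t : velocity gamma c t = 'D_1 (chart_coord c \o gamma) t.
Proof. exact: derive1E. Qed.

Lemma velocity_smooth c :
  smooth_on [set t | I t /\ dom c (gamma t)] (velocity gamma c).
Proof.
have [_ /(_ c) sc] := sgamma.
have -> : velocity gamma c = fun t => 'D_1 (chart_coord c \o gamma) t.
  by apply/funext => t; exact: velocityE.
exact: smooth_derive sc.
Qed.

Lemma curve_chart_near (c : chart M) t : I t -> dom c (gamma t) ->
  \forall s \near t, I s /\ dom c (gamma s).
Proof.
move=> It ct; apply: (@open_nbhs_nbhs _ t [set t | I t /\ dom c (gamma t)]).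
by split=> //; exact: curve_chart_open.
Qed.

(** Near [t] the curve read in [d] is the transition map applied to the curve read in [c], so this
    is the chain rule. *)
Lemma velocity_transform (c d : chart M) t :
  I t -> dom c (gamma t) -> dom d (gamma t) ->
  velocity gamma d t =
  'D_(velocity gamma c t) (chart_coord d \o param c) (chart_coord c (gamma t)).
Proof.
move=> It ct dt; rewrite !velocityE.
have dx := curve_differentiable It ct.
have dd : differentiable (chart_coord d \o param c) ((chart_coord c \o gamma) t).
  apply: (smooth_differentiable (@transition_smooth _ _ M c d)).
  by exists (gamma t).
apply: (etrans _ (derive_comp (1 : R) dx dd)); apply: near_eq_derive.
apply: filterS (curve_chart_near It ct) => s [_ cs] /=.
by rewrite chart_coordK.
Qed.

Lemma derive_fun_along (f : M -> R) (c : chart M) t : smooth_fun f ->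
  I t -> dom c (gamma t) ->
  is_derive t 1 (f \o gamma)
    ('D_(velocity gamma c t) (f \o param c) (chart_coord c (gamma t))).
Proof.
move=> sf It ct; have dx := curve_differentiable It ct.
have df := smooth_fun_differentiable sf (img_coord ct).
apply: (@near_eq_is_derive _ _ _ ((f \o param c) \o (chart_coord c \o gamma))).
  apply: filterS (curve_chart_near It ct) => s [_ cs] /=.
  by rewrite chart_coordK.
split; first exact/diff_derivable/(differentiable_comp dx).
by rewrite (derive_comp (1 : R) dx df) velocityE.
Qed.

(** No single chart need contain the whole curve, so smoothness is tested at one time [t] and proved
    in a chart around [gamma t]. *)
Lemma smooth_fun_along (f : M -> R) : smooth_fun f -> smooth_on I (f \o gamma).
Proof.
move=> sf k; apply/Ck_on_pointwise => t It.
have [c ct] := dom_cover (gamma t).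
apply: (@Ck_on_sub _ _ _ _ _ [set t | I t /\ dom c (gamma t)]).
  by move=> _ ->.
apply: (@Ck_on_open_eq _ _ _ _ _ ((f \o param c) \o (chart_coord c \o gamma))).
- exact: curve_chart_open.
- by move=> s [_ cs] /=; rewrite chart_coordK.
- apply: (@Ck_on_comp _ _ _ _ _ _ (img c)).
  + exact: curve_chart_open.
  + exact: img_open.
  + by move=> s [_ cs]; exact: img_coord.
  + by have [_ /(_ c) sc] := sgamma.
  + exact: sf.
Qed.

End smooth_curve.

Lemma levi_civita_scale (g : metric M) c x a u v :
  levi_civita g c x (a *: u) (a *: v) = a ^+ 2 *: levi_civita g c x u v.
Proof.
apply/rowP => k; rewrite !mxE mulr_sumr; apply: eq_bigr => i _.
rewrite mulr_sumr; apply: eq_bigr => j _; rewrite !mxE; ring.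
Qed.

Lemma innerZr (G : 'M[R]_n) (a : R) u v : inner G u (a *: v) = a * inner G u v.
Proof. by rewrite /inner linearZ /= -scalemxAr mxE. Qed.

Lemma vectorial_connection_scale (g : metric M) (V : vector_field M) c x a u v :
  vectorial_connection g V c x (a *: u) (a *: v) =
  a ^+ 2 *: vectorial_connection g V c x u v.
Proof.
rewrite /vectorial_connection levi_civita_scale innerZl !innerZr.
rewrite !scalerDr scalerN !scalerA; congr (_ + _ *: _ - _ *: _); ring.
Qed.

Section reparametrisation.
Variables (I J : set R) (gamma : R -> M) (tau : R -> R).
Hypotheses (oI : open I) (oJ : open J) (sgamma : smooth_curve I gamma).
Hypotheses (stau : smooth_on J tau) (tauJ : forall s, J s -> I (tau s)).

Let tau_diff s : J s -> differentiable tau s.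
Proof. exact: smooth_differentiable. Qed.

Let tau_continuous s : J s -> {for s, continuous tau}.
Proof. by move=> Js; exact/differentiable_continuous/tau_diff. Qed.

Let dtau_diff s : J s -> differentiable (derive1 tau) s.
Proof.
have -> : derive1 tau = fun s => 'D_1 tau s.
  by apply/funext => r; rewrite derive1E.
exact: (smooth_differentiable (smooth_derive _ stau)).
Qed.

Lemma smooth_curve_reparametrisation : smooth_curve J (gamma \o tau).
Proof.
have [cg sg] := sgamma.
have cgt s : J s -> {for s, continuous (gamma \o tau)}.
  by move=> Js; apply: continuous_comp; [exact: tau_continuous|exact/cg/tauJ].
split=> // c k.
apply: (@Ck_on_comp_real _ _ _ _ _ [set t | I t /\ dom c (gamma t)] tau
  (chart_coord c \o gamma)); last exact: sg.
- rewrite openE => s [Js cs]; apply: filterI; first exact: open_nbhs_nbhs.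
  exact: (nbhs_preimage (cgt s Js) (dom_open c) cs).
- exact: curve_chart_open.
- by move=> s [Js cs]; split=> //; exact: tauJ.
- by apply: Ck_on_sub (stau k) => s [].
Qed.

Lemma velocity_reparametrisation (c : chart M) s : J s -> dom c (gamma (tau s)) ->
  velocity (gamma \o tau) c s = derive1 tau s *: velocity gamma c (tau s).
Proof.
move=> Js cs.
have dt := (derivable1_diffP _ _).2 (tau_diff Js).
have dx := (derivable1_diffP _ _).2 (curve_differentiable sgamma (tauJ Js) cs).
by have [_] := derivable_comp_real dt dx; rewrite -derive1E.
Qed.

Lemma acceleration_reparametrisation (sigma : M -> R) (g : metric M)
    (c : chart M) s :
  riemannian g -> smooth_fun sigma -> J s -> dom c (gamma (tau s)) ->
  cov_deriv_along (levi_civita (conformal sigma g)) (gamma \o tau) c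
    (velocity (gamma \o tau) c) s =
  (derive1 (derive1 tau) s +
     derive1 tau s * derive1 (sigma \o gamma \o tau) s)
    *: velocity gamma c (tau s) +
  derive1 tau s ^+ 2 *:
    cov_deriv_along (vectorial_connection g (fun c x => - grad g sigma c x))
      gamma c (velocity gamma c) (tau s).
Proof.
move=> rg ss Js cs; have Is := tauJ Js.
have cx := img_coord cs.
have dtau := (derivable1_diffP _ _).2 (tau_diff Js).
have scomp := smooth_curve_reparametrisation.
have Dsigma : derive1 (sigma \o gamma \o tau) s = derive1 tau s *
    'D_(velocity gamma c (tau s)) (sigma \o param c)
      (chart_coord c (gamma (tau s))).
  have [d1 d2] := derive_fun_along oI sgamma ss Is cs.
  have [_] := derivable_comp_real dtau d1.
  by rewrite -derive1E (derive1E (sigma \o gamma)) d2.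
have dvel := smooth_differentiable (velocity_smooth sgamma c) (conj Is cs).
have Dvel : derive1 (velocity (gamma \o tau) c) s =
    derive1 (derive1 tau) s *: velocity gamma c (tau s) +
    derive1 tau s ^+ 2 *: derive1 (velocity gamma c) (tau s).
  rewrite derive1E.
  (* The formula for the reparametrised velocity is valid near [s], hence may be differentiated
     there. *)
  have E : 'D_1 (velocity (gamma \o tau) c) s =
      'D_1 (fun r => derive1 tau r *: (velocity gamma c \o tau) r) s.
    apply: near_eq_derive.
    apply: filterS (curve_chart_near oJ scomp Js cs) => r [Jr cr].
    exact: velocity_reparametrisation.
  have dcomp := differentiable_comp (tau_diff Js) dvel.
  apply: (etrans E); apply: (etrans (derive_scale (1 : R) (dtau_diff Js) dcomp)).
  rewrite -(derive1E (derive1 tau)).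
  have [_ ->] := derivable_comp_real dtau ((derivable1_diffP _ _).2 dvel).
  by rewrite scalerA expr2.
rewrite /cov_deriv_along Dvel /= velocity_reparametrisation //.
(* The vectorial connection is quadratic in the velocity, whence the factor [tau'^2]; the extra
   conformal term contributes [tau' (sigma \o gamma \o tau)'] times the velocity of [gamma]. *)
rewrite levi_civita_conformal // vectorial_connection_scale Dsigma.
have ds := smooth_fun_differentiable ss cx.
have -> : 'D_(derive1 tau s *: velocity gamma c (tau s)) (sigma \o param c)
      (chart_coord c (gamma (tau s))) = derive1 tau s *
    'D_(velocity gamma c (tau s)) (sigma \o param c)
      (chart_coord c (gamma (tau s))).
  by rewrite !(deriveE _ ds) linearZ.
rewrite scalerDl [in RHS]scalerDr scalerA -!addrA; congr (_ + _).
rewrite addrA addrC; congr (_ *: _ + _); ring.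
Qed.

End reparametrisation.
End curves.

(** * The constant of motion *)

Section momentum.
Variables (R : realType) (n : nat) (M : manifold R n) (g : metric M).
Variables (sigma : M -> R) (I : set R) (gamma : R -> M) (X : vector_field M).
Hypotheses (rg : riemannian g) (ss : smooth_fun sigma) (oI : open I).
Hypothesis geo :
  geodesic (vectorial_connection g (fun c x => - grad g sigma c x)) I gamma.
Hypothesis kX : killing (conformal sigma g) X.

Lemma derive_conformal_momentum (c : chart M) t : I t -> dom c (gamma t) ->
  is_derive t 1 (fun s => inner (conformal sigma g c (chart_coord c (gamma s)))
    (velocity gamma c s) (X c (chart_coord c (gamma s))))
  (derive1 (sigma \o gamma) t *
    inner (conformal sigma g c (chart_coord c (gamma t)))
      (velocity gamma c t) (X c (chart_coord c (gamma t)))).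
Proof.
move=> It ct; have [sgamma eqgamma] := geo.
have rh := conformal_riemannian rg ss.
have cx := img_coord ct.
have dx := curve_differentiable sgamma It ct.
have dv := smooth_differentiable (velocity_smooth sgamma c) (conj It ct).
have [[sX _] _] := kX.
have dX := smooth_differentiable (sX c) cx.
have dXx := differentiable_comp dx dX.
have dh i j := metric_differentiable i j rh cx.
have dhx i j : differentiable
    (fun s => conformal sigma g c ((chart_coord c \o gamma) s) i j) t.
  exact: (@differentiable_comp _ _ _ _ (chart_coord c \o gamma)
    (fun y => conformal sigma g c y i j) t dx).
split.
  by apply: diff_derivable; exact: (differentiable_inner dhx dv dXx).
apply: (etrans (@derive_inner_fun R R n _ _ _ t 1 dhx dv dXx)).
rewrite (derive_comp (1 : R) dx dX) -velocityE -(derive1E (velocity gamma c)).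
have -> : 'D_1 (fun s : R => inner (conformal sigma g c ((chart_coord c \o gamma) s))
      (velocity gamma c t) ((X c \o (chart_coord c \o gamma)) t)) t =
    'D_(velocity gamma c t) (fun y => inner (conformal sigma g c y)
      (velocity gamma c t) (X c (chart_coord c (gamma t))))
      (chart_coord c (gamma t)).
  rewrite velocityE.
  apply: (@derive_comp _ _ _ _ (chart_coord c \o gamma)
    (fun y => inner (conformal sigma g c y)
      ('D_1 (chart_coord c \o gamma) t) (X c (chart_coord c (gamma t)))) t 1 dx).
  by apply: differentiable_inner dh _ _; exact: differentiable_cst.
(* The geodesic equation of the vectorial connection, rewritten with the Levi-Civita connection of
   the conformal metric, so that Koszul's formula for that metric applies. *)
have acc : derive1 (velocity gamma c) t =
    derive1 (sigma \o gamma) t *: velocity gamma c t -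
    levi_civita (conformal sigma g) c (chart_coord c (gamma t))
      (velocity gamma c t) (velocity gamma c t).
  have [_ ds] := derive_fun_along oI sgamma ss It ct.
  rewrite levi_civita_conformal // (derive1E (sigma \o gamma)) ds.
  rewrite opprD addrCA subrr addr0.
  by apply/eqP; rewrite -addr_eq0; apply/eqP; exact: eqgamma.
rewrite acc innerDl innerNl innerZl /=.
have K := killing_equation (velocity gamma c t) rh kX cx.
have L := koszul (velocity gamma c t) (velocity gamma c t)
  (X c (chart_coord c (gamma t))) rh cx.
move: K L.
move: (inner _ _ ('D_(velocity gamma c t) (X c) _)) => a.
move: (inner _ (levi_civita _ _ _ _ _) _) => b.
move: (inner _ _ (X c _)) => d.
move: ('D_(X c _) _ _) => p; move: ('D_(velocity gamma c t) _ _) => q.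
move: (derive1 _ _) => r K L.
(* Here [K] reads [p + 2 * a = 0] and Koszul's formula [L] reads [2 * b = 2 * q - p]. The terms [q],
   [a] and [b] therefore cancel in the derivative, leaving [r * d]. *)
have -> : b = q + a by lra.
ring.
Qed.

Lemma momentum_conformalE (c : chart M) s : dom c (gamma s) ->
  expR (sigma (gamma s)) * inner (g c (chart_coord c (gamma s)))
    (velocity gamma c s) (X c (chart_coord c (gamma s))) =
  expR (- sigma (gamma s)) *
    inner (conformal sigma g c (chart_coord c (gamma s)))
      (velocity gamma c s) (X c (chart_coord c (gamma s))).
Proof.
move=> cs; rewrite innerZ chart_coordK // mulrA -expRD; congr (expR _ * _); ring.
Qed.

Lemma derive_momentum (c : chart M) t : I t -> dom c (gamma t) ->
  is_derive t 1 (fun s => expR (sigma (gamma s)) *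
    inner (g c (chart_coord c (gamma s)))
      (velocity gamma c s) (X c (chart_coord c (gamma s)))) 0.
Proof.
move=> It ct; have [sgamma _] := geo.
pose P s := inner (conformal sigma g c (chart_coord c (gamma s)))
  (velocity gamma c s) (X c (chart_coord c (gamma s))).
have dP : is_derive t 1 P (derive1 (sigma \o gamma) t * P t).
  exact: derive_conformal_momentum.
have [ds _] := derive_fun_along oI sgamma ss It ct.
have de : is_derive t 1 (expR \o (- (sigma \o gamma)))
    (expR (- (sigma (gamma t))) * - derive1 (sigma \o gamma) t).
  apply: is_derive1_comp; rewrite derive1E.
  by apply: is_deriveN; exact/derivableP.
apply: (@near_eq_is_derive _ _ _ ((expR \o (- (sigma \o gamma))) * P)).
  apply: filterS (curve_chart_near oI sgamma It ct) => s [_ cs].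
  by rewrite momentum_conformalE.
apply: is_derive_eq (is_deriveM de dP) _.
rewrite /GRing.scale /= !fctE; ring.
Qed.

Lemma momentum_chart (c d : chart M) t : I t ->
  dom c (gamma t) -> dom d (gamma t) ->
  inner (g c (chart_coord c (gamma t)))
    (velocity gamma c t) (X c (chart_coord c (gamma t))) =
  inner (g d (chart_coord d (gamma t)))
    (velocity gamma d t) (X d (chart_coord d (gamma t))).
Proof.
move=> It ct dt; have [sgamma _] := geo; have [_ _ _ tr] := rg.
have [[_ trX] _] := kX.
by rewrite (velocity_transform oI sgamma It ct dt) (trX c d _ ct dt) tr.
Qed.

Lemma momentum_constant : is_interval I ->
  exists k : R, forall c t, I t -> dom c (gamma t) ->
    expR (sigma (gamma t)) * inner (g c (chart_coord c (gamma t)))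
      (velocity gamma c t) (X c (chart_coord c (gamma t))) = k.
Proof.
move=> iI; have [sgamma _] := geo.
(* One function [F] on [I] is obtained by choosing a chart at each time. By independence of the
   chart it agrees near [t] with the expression in the fixed chart [ch t], so its derivative can be
   computed there. *)
pose ch t := sval (cid (dom_cover (gamma t))).
have chP t : dom (ch t) (gamma t) by exact: (svalP (cid (dom_cover (gamma t)))).
pose m c t := expR (sigma (gamma t)) * inner (g c (chart_coord c (gamma t)))
  (velocity gamma c t) (X c (chart_coord c (gamma t))).
pose F t := m (ch t) t.
have FE c t : I t -> dom c (gamma t) -> m c t = F t.
  by move=> It ct; rewrite /F /m (momentum_chart It ct (chP t)).
have dF t : I t -> is_derive t 1 F 0.
  move=> It; apply: near_eq_is_derive (derive_momentum It (chP t)).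
  apply: filterS (curve_chart_near oI sgamma It (chP t)) => s [Is cs].
  exact: FE.
have [[t0 It0]|nI] := pselect (exists t, I t).
  exists (F t0) => c t It ct; rewrite -/(m c t) FE //.
  exact: (derive_eq0_constant iI dF).
(* On an empty interval any constant will do. *)
by exists 0 => c t It; case: nI; exists t.
Qed.

End momentum.

(** * Primitives and inverses on an open interval *)

Section open_interval.
Variables (R : realType) (I : set R).
Hypotheses (oI : open I) (iI : is_interval I).

Lemma open_interval_segment s t : I s -> I t ->
  exists a b, [/\ I a, I b, a < s < b & a < t < b].
Proof.
have ex r : I r -> exists a b, [/\ I a, I b & a < r < b].
  move=> Ir; have /nbhs_ballP[e /= e0 he] : nbhs r I by exact: open_nbhs_nbhs.
  have e2 : 0 < e / 2 by rewrite divr_gt0.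
  have ee : e / 2 < e by rewrite ltr_pdivrMr // ltr_pMr // ltr1n.
  exists (r - e / 2), (r + e / 2); split.
  - by apply: he; rewrite -ball_normE /= opprB addrC subrK gtr0_norm.
  - apply: he; rewrite -ball_normE /= opprD addrA subrr add0r normrN.
    by rewrite gtr0_norm.
  - by rewrite ltrBlDr !ltrDl e2.
move=> Is It.
have [a1 [b1 [Ia1 Ib1 /andP[as1 sb1]]]] := ex s Is.
have [a2 [b2 [Ia2 Ib2 /andP[at2 tb2]]]] := ex t It.
exists (Num.min a1 a2), (Num.max b1 b2); split.
- by rewrite minEle; case: ifP.
- by rewrite maxEle; case: ifP.
- by rewrite gt_min as1 lt_max sb1.
- by rewrite gt_min at2 orbT lt_max tb2 orbT.
Qed.

Lemma exists_primitive (f : R -> R) :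
  (forall t, I t -> {for t, continuous f}) ->
  exists F : R -> R, forall t, I t -> is_derive t 1 F (f t).
Proof.
move=> cf.
have [[t0 It0]|nI] := pselect (exists t, I t); last first.
  by exists f => t It; case: nI; exists t.
(* Integrals start at a point [a] to the left of both [t0] and [t], so only increasing bounds occur;
   [G a t - G a t0] is then the oriented integral from [t0] to [t]. *)
pose G a x := \int[@lebesgue_measure R]_(y in `[a, x]) f y.
have dG a b x : I a -> I b -> a < x < b -> is_derive x 1 (G a) (f x).
  move=> Ia Ib /andP[ax xb].
  have Ix : I x by apply: (iI Ia Ib); rewrite !ltW.
  have intf : lebesgue_measure.-integrable `[a, b] (EFin \o f).
    apply: continuous_compact_integrable; first exact: segment_compact.
    apply: continuous_in_subspaceT => y; rewrite inE /= in_itv /= => yab.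
    exact/cf/(iI Ia Ib).
  have [dF DF] := continuous_FTC1_closed xb intf ax (cf x Ix).
  by split; [exact: dF|rewrite -derive1E; exact: DF].
have H t : exists ab : R * R, I t ->
    [/\ I ab.1, I ab.2, ab.1 < t0 < ab.2 & ab.1 < t < ab.2].
  have [It|nIt] := pselect (I t); last by exists (t, t).
  by have [a [b ?]] := open_interval_segment It0 It; exists (a, b).
pose A t := (sval (cid (H t))).1; pose B t := (sval (cid (H t))).2.
have AB t : I t -> [/\ I (A t), I (B t), A t < t0 < B t & A t < t < B t].
  exact: (svalP (cid (H t))).
pose F t := G (A t) t - G (A t) t0.
(* The value does not depend on the segment: [G a] and [G (A t)] are both primitives of [f] on the
   interval [K], which contains [t] and [t0], so their difference is constant there. *)
have FE a b t : I a -> I b -> a < t0 < b -> a < t < b ->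
    G a t - G a t0 = F t.
  move=> Ia Ib ab0 abt.
  have It : I t by apply: (iI Ia Ib); case/andP: abt => *; rewrite !ltW.
  have [IA IB AB0 ABt] := AB t It.
  pose K := [set y | (a < y < b) && (A t < y < B t)].
  have iK : is_interval K.
    move=> x y /andP[/andP[ax _] /andP[Ax _]] /andP[/andP[_ yb] /andP[_ yB]] z.
    move=> /andP[xz zy]; apply/andP; split; apply/andP; split.
    - exact: lt_le_trans xz.
    - exact: le_lt_trans yb.
    - exact: lt_le_trans xz.
    - exact: le_lt_trans yB.
  have dK y : K y -> is_derive y 1 (G a - G (A t)) 0.
    move=> /andP[ya yA]; rewrite -(subrr (f y)).
    by apply: is_deriveB; [exact: dG Ib ya|exact: dG IB yA].
  have := @derive_eq0_constant _ K (G a - G (A t)) t t0 iK dK.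
  have Kt : K t by apply/andP.
  have K0 : K t0 by apply/andP.
  rewrite /F !fctE /= => /(_ Kt K0); lra.
exists F => t It; have [IA IB AB0 ABt] := AB t It.
(* Near [t] the segment chosen for [t] serves every point, so [F] is locally a single integral up to
   a constant. *)
apply: (@near_eq_is_derive _ _ _ (G (A t) - cst (G (A t) t0))).
  have : \forall y \near t, A t < y < B t.
    have := @near_in_itvoo R (A t) (B t) t; rewrite in_itv => /(_ ABt).
    by apply: filterS => y; rewrite in_itv.
  by apply: filterS => y yAB; rewrite -(FE _ _ _ IA IB AB0 yAB).
rewrite -(subr0 (f t)); apply: is_deriveB; exact: dG IB ABt.
Qed.

(** A derivative without zeros makes [T] injective by the mean value theorem. The image [J] is an
    interval by connectedness and open because [T] has a continuous local inverse. *)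
Lemma exists_inverse (T dT : R -> R) :
  (forall t, I t -> is_derive t 1 T (dT t)) -> (forall t, I t -> dT t != 0) ->
  exists (J : set R) (tau : R -> R),
    [/\ open_interval J, set_bij J I tau,
        forall t, I t -> J (T t) /\ tau (T t) = t &
        forall s, J s -> T (tau s) = s /\ is_derive s 1 tau (dT (tau s))^-1].
Proof.
move=> dTI dT0.
have cT t : I t -> {for t, continuous T}.
  move=> It; apply/differentiable_continuous/derivable1_diffP.
  by have [] := dTI t It.
have ltT a b : I a -> I b -> a < b -> T a <> T b.
  move=> Ia Ib ab Tab.
  have Iab t : a <= t <= b -> I t by exact: iI.
  have [t /Iab It|c /Iab Ic] := @MVT_derivable _ T a b ab.
    by have [] := dTI t It.
  have [_ ->] := dTI c Ic; rewrite Tab subrr => /esym/eqP.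
  by rewrite mulf_eq0 (negPf (dT0 c Ic)) /= subr_eq0 gt_eqF.
have injT a b : I a -> I b -> T a = T b -> a = b.
  move=> Ia Ib Tab; case: (ltgtP a b) => // ab.
    by case: (ltT a b).
  by case: (ltT b a).
pose J := T @` I.
(* The inverse is chosen pointwise; outside [J] its value is arbitrary, and [s] serves as a
   default. *)
have H s : exists t, J s -> I t /\ T t = s.
  have [[t It <-]|nJ] := pselect (J s); first by exists t.
  by exists s.
pose tau s := sval (cid (H s)).
have tauP s : J s -> I (tau s) /\ T (tau s) = s by exact: (svalP (cid (H s))).
have JT t : I t -> J (T t) by exists t.
have TK t : I t -> tau (T t) = t.
  move=> It; have [Itau Ttau] := tauP _ (JT t It); exact: injT.
have NI t : I t -> nbhs t I by move=> It; exact: open_nbhs_nbhs.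
have nK t : I t -> {near t, cancel T tau}.
  by move=> It; apply: filterS (NI t It) => y; exact: TK.
have nC t : I t -> {near t, continuous T}.
  by move=> It; apply: filterS (NI t It) => y; exact: cT.
exists J, tau; split.
- split.
    rewrite openE => _ [t It <-].
    have [ctau Ktau] := near_can_continuousAcan_sym (nK t It) (nC t It).
    have ct := nbhs_singleton ctau.
    have NtauI : \forall y \near T t, I (tau y).
      by apply: (nbhs_preimage ct oI); rewrite TK.
    apply: filterS2 NtauI Ktau => y Iy <-.
    exact: JT.
  apply/connected_intervalP; apply: connected_continuous_connected.
    exact/connected_intervalP.
  by apply: continuous_in_subspaceT => y; rewrite inE; exact: cT.
- split.
  + by move=> s Js; have [] := tauP s Js.
  + move=> s r; rewrite !inE => Js Jr E.
    by rewrite -(tauP s Js).2 -(tauP r Jr).2 E.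
  + by move=> t It; exists (T t); [exact: JT|exact: TK].
- by move=> t It; split; [exact: JT|exact: TK].
- move=> s Js; have [Is Ts] := tauP s Js; split=> //.
  have := is_derive_inverse (nK _ Is) (nC _ Is) (dTI _ Is) (dT0 _ Is).
  by rewrite Ts.
Qed.

End open_interval.

(** Bootstrapping: if [tau] has order [k], so does [h \o tau], which is the derivative of [tau],
    hence [tau] has order [k.+1]. *)
Lemma smooth_autonomous (R : realType) (I J : set R) (h tau : R -> R) :
  open I -> open J -> (forall s, J s -> I (tau s)) -> smooth_on I h ->
  (forall s, J s -> is_derive s 1 tau (h (tau s))) -> smooth_on J tau.
Proof.
move=> oI oJ JI sh dtau.
have df s : J s -> differentiable tau s.
  by move=> Js; apply/derivable1_diffP; have [] := dtau s Js.
move=> k; elim: k => [|k IH].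
  by move=> s Js; exact/differentiable_continuous/df.
split=> // v.
apply: (@Ck_on_open_eq _ _ _ _ _ (fun s => v *: (h \o tau) s)) => //.
  move=> s Js; rewrite (deriveE _ (df s Js)) (diff1E (df s Js)) derive1E.
  by have [_ ->] := dtau s Js.
apply: (@Ck_on_linear _ _ _ _ k J ( *:%R v)) => //.
  exact: scaler_continuous.
exact: (Ck_on_comp_real oJ oI JI IH (sh k)).
Qed.

(** * The equation of the reparametrisation *)

Section maximal_solution.
Variables (R : realType) (I : set R) (rho : R -> R).
Hypotheses (oI : open_interval I) (srho : smooth_on I rho).

Let rho_derivable t : I t -> derivable rho t 1.
Proof. by move=> It; apply/derivable1_diffP; exact: smooth_differentiable It. Qed.

(** The derivative of [tau' e^{rho \o tau}] is [e^{rho \o tau}] times the left-hand side of the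
    equation. In the application [rho] is [sigma \o gamma]. *)
Lemma ode_first_integral (J : set R) (tau : R -> R) s0 s :
  open_interval J -> (forall r, J r -> I (tau r)) ->
  (forall r, J r -> [/\ derivable tau r 1, derivable (derive1 tau) r 1 &
    derive1 (derive1 tau) r + derive1 tau r * derive1 (rho \o tau) r = 0]) ->
  J s0 -> J s ->
  derive1 tau s * expR (rho (tau s)) = derive1 tau s0 * expR (rho (tau s0)).
Proof.
move=> [_ iJ] JI ode Js0 Js.
apply: (@derive_eq0_constant _ J
  (derive1 tau * (expR \o (rho \o tau))) s s0 iJ _ Js Js0) => r Jr.
have [dt ddt eq] := ode r Jr.
have [dr _] := derivable_comp_real dt (rho_derivable (JI r Jr)).
have de : is_derive r 1 (expR \o (rho \o tau))
    (expR (rho (tau r)) * derive1 (rho \o tau) r).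
  by apply: is_derive1_comp; rewrite derive1E; exact/derivableP.
have dd : is_derive r 1 (derive1 tau) (derive1 (derive1 tau) r).
  rewrite derive1E; exact: (derivableP ddt).
apply: is_derive_eq (is_deriveM dd de) _.
rewrite -[RHS](mulr0 (expR (rho (tau r)))) -eq /GRing.scale /=; ring.
Qed.

(** By the first integral the equation reduces to [tau' = h(tau)], which is solved by separating
    variables: [tau] is the inverse of a primitive [T] of [1/h], and [J] is the image of [I] under
    [T]. *)
Lemma exists_maximal_solution s0 t0 v0 : I t0 -> v0 != 0 ->
  exists (J : set R) (tau : R -> R),
    [/\ open_interval J /\ reparametrisation J I tau,
        [/\ J s0, tau s0 = t0 & derive1 tau s0 = v0],
        forall s, J s -> [/\ derivable tau s 1, derivable (derive1 tau) s 1 &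
          derive1 (derive1 tau) s + derive1 tau s * derive1 (rho \o tau) s = 0] &
        forall (J' : set R) (tau' : R -> R),
          open_interval J' -> set_fun J' I tau' ->
          [/\ J' s0, tau' s0 = t0 & derive1 tau' s0 = v0] ->
          (forall s, J' s -> [/\ derivable tau' s 1, derivable (derive1 tau') s 1 &
            derive1 (derive1 tau') s +
              derive1 tau' s * derive1 (rho \o tau') s = 0]) ->
          J' `<=` J /\ (forall s, J' s -> tau' s = tau s)].
Proof.
move=> It0 v00; have [oI' iI] := oI.
(* The value of the first integral fixed by the initial data; it is nonzero because [v0] is. *)
pose k := v0 * expR (rho t0).
have k0 : k != 0 by rewrite mulf_neq0 // gt_eqF // expR_gt0.
pose h t := k * expR (-1 * rho t).
have h0 t : h t != 0 by rewrite mulf_neq0 // gt_eqF // expR_gt0.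
have sh : smooth_on I h.
  move=> m; apply: Ck_onM => //; first exact: Ck_on_cst.
  apply: (@Ck_on_comp_real _ _ _ _ _ setT (fun t => -1 * rho t) (@expR R)) => //.
  - exact: openT.
  - by apply: Ck_onM => //; exact: Ck_on_cst.
  - exact: smooth_expR.
have cV t : I t -> {for t, continuous (fun r => (h r)^-1)}.
  move=> It; apply: cvgV; first exact: h0.
  exact: (sh 0%N t It).
have [F dF] := exists_primitive oI' iI cV.
(* The constant is adjusted so that [T t0 = s0]. *)
pose T := F - cst (F t0 - s0).
have dT t : I t -> is_derive t 1 T (h t)^-1.
  move=> It; rewrite -(subr0 (h t)^-1).
  by apply: is_deriveB; exact: dF.
have [J [tau [oJ bij JT Jtau]]] :=
  exists_inverse oI' iI dT (fun t _ => invr_neq0 (h0 t)).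
have [oJ' iJ] := oJ.
have JI s : J s -> I (tau s) by have [+ _ _] := bij; exact.
have dtau s : J s -> is_derive s 1 tau (h (tau s)).
  by move=> Js; have [_] := Jtau s Js; rewrite invrK.
have dtauE s : J s -> derive1 tau s = h (tau s).
  by move=> Js; have [_ <-] := dtau s Js; rewrite derive1E.
have T0 : T t0 = s0 by rewrite /T !fctE /= subKr.
have [Js0 tau0] := JT t0 It0; rewrite T0 in Js0 tau0.
have stau := smooth_autonomous oI' oJ' JI sh dtau.
exists J, tau; split.
- split=> //; split=> // s Js; by rewrite dtauE.
- split=> //; rewrite dtauE // tau0 /h /k mulN1r -mulrA -expRD subrr expR0.
  by rewrite mulr1.
- move=> s Js; have [dt _] := dtau s Js.
  have [dr _] := derivable_comp_real dt (rho_derivable (JI s Js)).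
  have dd : is_derive s 1 (derive1 tau)
      (k *: (expR (- rho (tau s)) * - derive1 (rho \o tau) s)).
    apply: (@near_eq_is_derive _ _ _ (k *: (expR \o (- (rho \o tau))))).
      have NJ : nbhs s J by exact: open_nbhs_nbhs.
      by apply: filterS NJ => r Jr; rewrite dtauE // /h mulN1r.
    apply: is_deriveZ; apply: is_derive1_comp; rewrite derive1E.
    by apply: is_deriveN; exact/derivableP.
  have [ddt ddtE] := dd.
  split; [exact: dt|exact: ddt|].
  rewrite (derive1E (derive1 tau)) ddtE dtauE // /h mulN1r.
  rewrite /GRing.scale /=; ring.
- move=> J' tau' oJ1 J'I [J's0 tau'0 dtau'0] ode.
  (* [T] inverts every competing solution: [T \o tau'] has derivative 1 and takes the value [s0] at
     [s0]. This yields both [J' s = J (T (tau' s))] and the equality with [tau]. *)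
  have H s : J' s -> T (tau' s) = s.
    move=> J's; have [_ iJ'] := oJ1.
    have E := @derive_eq0_constant _ J' ((T \o tau') - id) s s0 iJ' _ J's J's0.
    apply/eqP; rewrite -subr_eq0; apply/eqP.
    apply: (etrans (E _)); last by rewrite !fctE /= tau'0 T0 subrr.
    move=> r J'r; have [dt' _ _] := ode r J'r.
    have [dTr DTr] := dT _ (J'I r J'r).
    have dc := derivable_comp_real dt' dTr.
    rewrite -(subrr (1 : R)); apply: is_deriveB.
    apply: is_derive_eq dc _.
    (* With the same initial data the first integral has the same value [k], so the competitor
       satisfies the same first-order equation. *)
    have Q := ode_first_integral oJ1 J'I ode J's0 J'r.
    rewrite dtau'0 tau'0 -/k in Q.
    have -> : derive1 tau' r = h (tau' r).
      by rewrite /h mulN1r -Q -mulrA -expRD subrr expR0 mulr1.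
    by rewrite (derive1E T) DTr [LHS]divff.
  have H2 s : J' s -> tau' s = tau s.
    by move=> J's; have [_] := JT _ (J'I s J's); rewrite H.
  split=> // s J's; have [+ _] := JT _ (J'I s J's); by rewrite H.
Qed.

End maximal_solution.

(** * Reparametrised geodesics and the assembly of the theorem *)

Lemma velocity_neq0 (R : realType) (n : nat) (M : manifold R n) (g : metric M)
    (gamma : R -> M) (c : chart M) (t : R) :
  0 < speed g gamma c t -> velocity gamma c t != 0.
Proof.
apply: contraTneq => v0.
by rewrite /speed v0 /inner !mul0mx mxE sqrtr0 ltxx.
Qed.

(** Along a geodesic of the vectorial connection, the acceleration of [gamma \o tau] is the
    left-hand side of the equation times the velocity of [gamma], which is nonzero; one vanishes
    exactly when the other does. *)
Lemma geodesic_reparametrisation (R : realType) (n : nat) (M : manifold R n)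
    (g : metric M) (sigma : M -> R) (I J : set R) (gamma : R -> M)
    (tau : R -> R) :
  riemannian g -> smooth_fun sigma -> open I -> open J ->
  geodesic (vectorial_connection g (fun c x => - grad g sigma c x)) I gamma ->
  (forall c t, I t -> dom c (gamma t) -> velocity gamma c t != 0) ->
  smooth_on J tau -> (forall s, J s -> I (tau s)) ->
  geodesic (levi_civita (conformal sigma g)) J (gamma \o tau) <->
  solves_ode sigma gamma J tau.
Proof.
move=> rg ss oI oJ [sgamma geo] vel stau JI.
have acc c s (Js : J s) (cs : dom c (gamma (tau s))) :
    cov_deriv_along (levi_civita (conformal sigma g)) (gamma \o tau) c
      (velocity (gamma \o tau) c) s =
    (derive1 (derive1 tau) s +
      derive1 tau s * derive1 (sigma \o gamma \o tau) s)
      *: velocity gamma c (tau s).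
  rewrite (acceleration_reparametrisation oI oJ sgamma stau JI rg ss Js cs).
  by rewrite (geo c _ (JI s Js) cs) scaler0 addr0.
split=> [[_ G] s Js|ode].
  have [c cs] := dom_cover (gamma (tau s)).
  split.
  - by apply/derivable1_diffP; exact: smooth_differentiable Js.
  - have -> : derive1 tau = fun r => 'D_1 tau r.
      by apply/funext => r; rewrite derive1E.
    apply: diff_derivable.
    exact: (smooth_differentiable (smooth_derive _ stau)).
  - have /eqP := G c s Js cs; rewrite (acc c s Js cs) scaler_eq0.
    by rewrite (negPf (vel _ _ (JI s Js) cs)) orbF => /eqP.
split; first exact: (smooth_curve_reparametrisation oI oJ sgamma stau JI).
move=> c s Js cs; have [_ _ eq] := ode s Js.
by rewrite (acc c s Js cs) eq scale0r.
Qed.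

(** The equation of [tau] is of second order, so uniqueness is expressed relative to initial data
    [s0], [t0], [v0], and by comparison with solutions on other open intervals. A zero [v0] would
    give only constant solutions, which reparametrise nothing. *)
Theorem theorem3p1 (R : realType) (n : nat) (M : manifold R n)
    (g : metric M) (hg : riemannian g)
    (sigma : M -> R) (hsigma : smooth_fun sigma)
    (V : vector_field M) (hV : V = fun c x => - grad g sigma c x)
    (I : set R) (hI : open_interval I) (gamma : R -> M)
    (hgamma : geodesic (vectorial_connection g V) I gamma)
    (E : R) (hE : 0 < E)
    (hspeed : forall c t, I t -> dom c (gamma t) -> speed g gamma c t = E) :
  ((forall s0 t0 v0 : R, I t0 -> v0 != 0 ->
      exists (J : set R) (tau : R -> R),
        [/\ open_interval J /\ reparametrisation J I tau,
            [/\ J s0, tau s0 = t0 & derive1 tau s0 = v0],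
            geodesic (levi_civita (conformal sigma g)) J (gamma \o tau),
            solves_ode sigma gamma J tau &
            forall (J' : set R) (tau' : R -> R),
              open_interval J' -> set_fun J' I tau' ->
              [/\ J' s0, tau' s0 = t0 & derive1 tau' s0 = v0] ->
              solves_ode sigma gamma J' tau' ->
              J' `<=` J /\ (forall s, J' s -> tau' s = tau s)]) /\
   (forall (J : set R) (tau : R -> R),
      open_interval J -> reparametrisation J I tau ->
      (geodesic (levi_civita (conformal sigma g)) J (gamma \o tau) <->
       solves_ode sigma gamma J tau))) /\
  (forall X : vector_field M, killing (conformal sigma g) X ->
     exists k : R, forall c t, I t -> dom c (gamma t) ->
       expR (sigma (gamma t)) *
         inner (g c (chart_coord c (gamma t)))
               (velocity gamma c t) (X c (chart_coord c (gamma t))) = k).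
Proof.
subst V; have [oI iI] := hI; have [sgamma _] := hgamma.
have vel c t : I t -> dom c (gamma t) -> velocity gamma c t != 0.
  by move=> It ct; apply: (@velocity_neq0 _ _ _ g); rewrite hspeed.
have key (J : set R) (tau : R -> R) :
    open_interval J -> reparametrisation J I tau ->
    (geodesic (levi_civita (conformal sigma g)) J (gamma \o tau) <->
     solves_ode sigma gamma J tau).
  move=> [oJ _] [stau [JI _ _] _].
  exact: (geodesic_reparametrisation hg hsigma oI oJ hgamma vel stau JI).
split; [split=> // s0 t0 v0 It0 v00|move=> X kX].
  have [J [tau [[oJ rep] init ode max]]] := exists_maximal_solution hI
    (smooth_fun_along oI sgamma hsigma) s0 It0 v00.
  exists J, tau; split=> //.
  exact: (key J tau oJ rep).2.
exact: (momentum_constant hg hsigma oI hgamma kX iI).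
Qed.
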